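(* Let $f\colon\mathfrak X\to\mathfrak Y$ be a morphism of pseudo finite type of locally noetherian formal schemes with $\mathfrak Y$ of characteristic $p$, and let $F_{\mathfrak X/\mathfrak Y}\colon\mathfrak X\to\mathfrak X^{(p)}$ be the relative Frobenius morphism of $\mathfrak X$ over $\mathfrak Y$. Then: (1) $F_{\mathfrak X/\mathfrak Y}$ is adic. (2) $F_{\mathfrak X/\mathfrak Y}$ is a homeomorphism.
   Context: $p$ is a prime number. A locally noetherian formal scheme $\mathfrak Y$ is of characteristic $p$ if $p\cdot\mathcal O_{\mathfrak Y}=0$. A morphism $f\colon\mathfrak X\to\mathfrak Y$ is adic if for some (equivalently any) Ideal of definition $\mathcal K$ of $\mathfrak Y$, $f^*(\mathcal K)\mathcal O_{\mathfrak X}$ is an Ideal of definition of $\mathfrak X$. It is of pseudo finite type if, for Ideals of definition $\mathcal J\subset\mathcal O_{\mathfrak X}$, $\mathcal K\subset\mathcal O_{\mathfrak Y}$ with $f^*(\mathcal K)\mathcal O_{\mathfrak X}\subset\mathcal J$, the induced morphism of schemes $(\mathfrak X,\mathcal O_{\mathfrak X}/\mathcal J)\to(\mathfrak Y,\mathcal O_{\mathfrak Y}/\mathcal K)$ is of finite type. The absolute Frobenius $F_{\mathfrak Y}\colon\mathfrak Y\to\mathfrak Y$ is the identity on the underlying space and $a\mapsto a^p$ on sections; likewise $F_{\mathfrak X}$. $\mathfrak X^{(p)}:=\mathfrak X\times_{\mathfrak Y,F_{\mathfrak Y}}\mathfrak Y$ (fiber product of formal schemes), with structure map $f^{(p)}\colon\mathfrak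 X^{(p)}\to\mathfrak Y$ the second projection, and $F_{\mathfrak X/\mathfrak Y}\colon\mathfrak X\to\mathfrak X^{(p)}$ is the unique morphism whose composite with the projection $\mathfrak X^{(p)}\to\mathfrak X$ is $F_{\mathfrak X}$ and whose composite with $f^{(p)}$ is $f$. *)

(* Defs.v *)
From HB Require Import structures.
From mathcomp Require Import all_boot ssralg.
From mathcomp Require Import all_classical topology tvs.

Set Implicit Arguments.
Unset Strict Implicit.
Unset Printing Implicit Defensive.
Import GRing.Theory.
Local Open Scope classical_set_scope.
Local Open Scope ring_scope.

(* Rings are [comPzRingType]s: the zero ring, the ring of sections over the   *)
(* empty set, has to be allowed.                                              *)

(** * Ideals *)

Section Ideals.
Variable R : comPzRingType.

Definition is_ideal (I : set R) : Prop :=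
  [/\ I 0, (forall x y, I x -> I y -> I (x + y)) & forall a x, I x -> I (a * x)].

Definition ideal_gen (E : set R) : set R := smallest is_ideal E.

Definition ideal_mul (I J : set R) : set R :=
  ideal_gen [set z | exists x y, [/\ I x, J y & z = x * y]].

Fixpoint ideal_pow (I : set R) (n : nat) : set R :=
  if n is m.+1 then ideal_mul I (ideal_pow I m) else setT.

Definition is_prime_ideal (P : set R) : Prop :=
  [/\ is_ideal P, ~ P 1 & forall x y, P (x * y) -> P x \/ P y].

Definition noetherian : Prop :=
  forall I, is_ideal I -> exists s : seq R, I = ideal_gen [set` s].

End Ideals.

Definition is_unit (R : comPzRingType) (x : R) : Prop := exists y, x * y = 1.

Definition is_localization (A L : comPzRingType) (f : A) (i : A -> L) : Prop :=
  [/\ is_unit (i f),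
      (forall l, exists a n, l * i f ^+ n = i a)
    & forall a, i a = 0 -> exists n, f ^+ n * a = 0].

Definition finite_type_ring (A B : comPzRingType) (phi : A -> B) : Prop :=
  exists ts : seq B, forall S : set B,
    (forall a, S (phi a)) -> (forall t, t \in ts -> S t) ->
    (forall x y, S x -> S y -> S (x + y)) ->
    (forall x y, S x -> S y -> S (x * y)) ->
    forall b, S b.

(** * Topological rings *)

HB.mixin Record isTopologicalComRing R & Topological R & GRing.ComPzRing R := {
  mul_continuous : continuous (fun x : R * R => x.1 * x.2)
}.

#[short(type="topComRingType")]
HB.structure Definition TopologicalComRing :=
  {R of TopologicalZmodule R & GRing.ComPzRing R & isTopologicalComRing R}.

Section TopologicalRings.
Variable A : topComRingType.

Definition complete_separated : Prop :=
  hausdorff_space A /\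
  forall F : set_system A, ProperFilter F ->
    (forall V, nbhs 0 V -> exists x, F [set y | V (y - x)]) ->
    exists l : A, F --> l.

Definition ring_ideal_of_def (I : set A) : Prop :=
  [/\ is_ideal I, open I & forall V, nbhs 0 V -> exists n, ideal_pow I n `<=` V].

Definition adic_ring : Prop :=
  complete_separated /\
  exists I, ring_ideal_of_def I /\ forall n, open (ideal_pow I n).

End TopologicalRings.

(* [phi] exhibits [B] as the completed ring of fractions A_{f}: the separated *)
(* completion of the localization A_f, where A_f carries the topology whose   *)
(* basic neighbourhoods of 0 are the ideals U A_f, U an open ideal of A.  The *)
(* completion is recognised by: complete separated, dense image, and the      *)
(* topology of A_f is induced by that of [B].                                 *)
Definition is_completed_localization (A B : topComRingType) (f : A)
    (phi : A -> B) : Prop :=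
  exists (L : comPzRingType) (i : {rmorphism A -> L}) (j : {rmorphism L -> B}),
  [/\ is_localization f i, phi =1 j \o i, complete_separated B, dense (range j)
    & forall N : set L,
        (exists U : set A, [/\ is_ideal U, open U & ideal_gen (i @` U) `<=` N])
        <-> (exists V, nbhs (0 : B) V /\ j @^-1` V `<=` N)].

(** * Prime spectra *)

(* The prime ideals satisfying [Q], topologised as a subspace of Spec A.      *)
Record zspec (A : comPzRingType) (Q : set (set A)) := Zspec {
  zideal :> set A;
  zidealP : is_prime_ideal zideal;
  zidealQ : Q zideal
}.

HB.instance Definition _ A Q := gen_eqMixin (@zspec A Q).
HB.instance Definition _ A Q := gen_choiceMixin (@zspec A Q).

Section Zariski.
Variables (A : comPzRingType) (Q : set (set A)).

Definition basic_open (f : A) : set (zspec Q) := [set q | ~ zideal q f].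

Definition zariski_open : set_system (zspec Q) :=
  [set W | forall q, W q -> exists f, basic_open f q /\ basic_open f `<=` W].

Lemma zariski_openT : zariski_open setT.
Proof. by move=> q _; exists 1; split=> //=; case: (zidealP q). Qed.

Lemma zariski_openI : setI_closed zariski_open.
Proof.
move=> V W Vo Wo q [/Vo [f [qf fV]] /Wo [g [qg gW]]].
exists (f * g); split.
  by move=> fg; case: (zidealP q) => _ _ /(_ _ _ fg) [].
move=> r rfg; split; [apply: fV => rf|apply: gW => rg]; apply: rfg;
  case: (zidealP r) => -[_ _ idr] _ _; last exact: idr.
by rewrite mulrC; apply: idr.
Qed.

Lemma zariski_open_bigU (I : Type) (W : I -> set (zspec Q)) :
  (forall i, zariski_open (W i)) -> zariski_open (\bigcup_i W i).
Proof.
move=> Wo q [i _ /Wo [f [qf fW]]]; exists f; split=> // r /fW ?.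
by exists i.
Qed.

HB.instance Definition _ := isOpenTopological.Build (zspec Q)
  zariski_openT zariski_openI zariski_open_bigU.

End Zariski.

Definition Spec (A : comPzRingType) : topologicalType := zspec (@setT (set A)).

Definition Spf (A : topComRingType) : topologicalType :=
  zspec [set P : set A | open P].

Definition open_embedding (T X : topologicalType) (h : T -> X) (U : set X) :=
  [/\ injective h, continuous h, (forall W, open W -> open (h @` W))
    & range h = U].

(** * Sheaves *)

Record opens (X : topologicalType) := Opens {
  oset :> set X;
  osetP : open oset
}.

Definition opreim (X Y : topologicalType) (f : X -> Y) (fc : continuous f)
    (V : opens Y) : opens X :=
  Opens (open_comp (fun x _ => fc x) (osetP V)).

Section Sheaves.
Variable X : topologicalType.

Definition is_sheaf (sec : opens X -> comPzRingType)
    (res : forall U V : opens X, V `<=` U -> {rmorphism sec U -> sec V}) : Prop :=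
  [/\ (forall (U : opens X) (i : U `<=` U) s, res U U i s = s),
      (forall (U V W : opens X) (i : V `<=` U) (j : W `<=` V) (k : W `<=` U) s,
         res V W j (res U V i s) = res U W k s),
      (forall (U : opens X) (I : Type) (V : I -> opens X) (i : forall k, V k `<=` U),
         U `<=` \bigcup_k (V k : set X) ->
         forall s t, (forall k, res U (V k) (i k) s = res U (V k) (i k) t) ->
         s = t)
    & (forall (U : opens X) (I : Type) (V : I -> opens X) (i : forall k, V k `<=` U),
         U `<=` \bigcup_k (V k : set X) ->
         forall s : (forall k, sec (V k)),
         (forall k l (W : opens X) (ik : W `<=` V k) (il : W `<=` V l),
            res (V k) W ik (s k) = res (V l) W il (s l)) ->
         exists t, forall k, res U (V k) (i k) t = s k)].

Record sheaf := Sheaf {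
  sec :> opens X -> comPzRingType;
  res : forall U V : opens X, V `<=` U -> {rmorphism sec U -> sec V};
  sheafP : is_sheaf res
}.

(* A sheaf with values in topological rings: moreover, for every open cover,  *)
(* the sections over U carry the initial topology for the restriction maps.   *)
Record tsheaf := Tsheaf {
  tsec :> opens X -> topComRingType;
  tres : forall U V : opens X, V `<=` U -> {rmorphism tsec U -> tsec V};
  tsheafP : @is_sheaf (fun U => tsec U) tres;
  tres_continuous : forall (U V : opens X) (i : V `<=` U), continuous (tres i);
  tsheaf_initial : forall (U : opens X) (I : Type) (V : I -> opens X)
      (i : forall k, V k `<=` U), U `<=` \bigcup_k (V k : set X) ->
    forall (s : tsec U) (F : set_system (tsec U)), Filter F ->
    (forall k, tres (i k) @ F --> tres (i k) s) -> F --> s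
}.

Coercion sheaf_of_tsheaf (O : tsheaf) : sheaf := Sheaf (tsheafP O).

End Sheaves.

Arguments res {X O U V} : rename.
Arguments tres {X O U V} : rename.

(** * Locally noetherian formal schemes *)

(* An isomorphism of (U, O|U) with Spf A, A a noetherian adic ring.  The      *)
(* structure sheaf of Spf A is the sheaf of topological rings with sections   *)
(* A_{f} over D(f), whence an isomorphism amounts to a homeomorphism of Spf A *)
(* with U and compatible identifications of O(D(f)) with A_{f}.               *)
Record formal_chart (X : topologicalType) (O : tsheaf X) (U : opens X) :=
    FormalChart {
  fc_ring : topComRingType;
  fc_noetherian : noetherian fc_ring;
  fc_adic : adic_ring fc_ring;
  fc_map : Spf fc_ring -> X;
  fc_embedding : open_embedding fc_map U;
  fc_sec : {rmorphism fc_ring -> O U};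
  fc_loc : forall (f : fc_ring) (V : opens X) (i : V `<=` U),
    V = fc_map @` basic_open f :> set X ->
    is_completed_localization f (tres i \o fc_sec)
}.

Arguments fc_map {X O U} c : rename.

Record lnFormalScheme := LnFormalScheme {
  fs_space :> topologicalType;
  fs_sheaf : tsheaf fs_space;
  fs_local : forall x : fs_space, exists U : opens fs_space,
    oset U x /\ inhabited (formal_chart fs_sheaf U)
}.

(* The germ of [s] at [x] is a unit of the stalk. *)
Definition germ_unit (X : topologicalType) (O : sheaf X) (U : opens X) (s : O U)
    (x : X) : Prop :=
  exists (W : opens X) (i : W `<=` U), oset W x /\ is_unit (res i s).

(* Morphisms of topologically ringed spaces that are local on stalks. *)
Record mor (X Y : lnFormalScheme) := Mor {
  bmap :> X -> Y;
  bmap_continuous : continuous bmap;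
  comor : forall V : opens Y,
    {rmorphism fs_sheaf Y V -> fs_sheaf X (opreim bmap_continuous V)};
  comor_continuous : forall V, continuous (comor V);
  comor_res : forall (V W : opens Y) (i : W `<=` V)
      (j : opreim bmap_continuous W `<=` opreim bmap_continuous V) (s : fs_sheaf Y V),
    comor W (tres i s) = tres j (comor V s);
  comor_local : forall (V : opens Y) (s : fs_sheaf Y V) (x : X),
    oset V (bmap x) -> germ_unit (O := fs_sheaf X) (comor V s) x ->
    germ_unit (O := fs_sheaf Y) s (bmap x)
}.

Arguments bmap_continuous {X Y} f : rename.

(* Equality of morphisms: same map, same sections; the latter are compared by *)
(* restriction, as they live over the two preimages of V.                     *)
Definition mor_eq (X Y : lnFormalScheme) (f g : mor X Y) : Prop :=
  f =1 g /\
  forall (V : opens Y) (s : fs_sheaf Y V) (W : opens X)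
    (i : W `<=` opreim (bmap_continuous f) V)
    (j : W `<=` opreim (bmap_continuous g) V),
    tres i (comor f V s) = tres j (comor g V s).

Section Composition.
Variables (X Y Z : lnFormalScheme) (g : mor Y Z) (f : mor X Y).

Let gfc : continuous (g \o f) :=
  fun x => continuous_comp (bmap_continuous f x) (bmap_continuous g (f x)).

Let sub (V : opens Z) :
  opreim gfc V `<=` opreim (bmap_continuous f) (opreim (bmap_continuous g) V)
  := fun x Vx => Vx.

Let gf_comor (V : opens Z) : {rmorphism fs_sheaf Z V -> fs_sheaf X (opreim gfc V)} :=
  tres (@sub V) \o (comor f (opreim (bmap_continuous g) V) \o comor g V).

Lemma comp_continuous V : continuous (gf_comor V).
Proof.
move=> s; apply: continuous_comp; last exact: tres_continuous.
by apply: continuous_comp; exact: comor_continuous.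
Qed.

Lemma comp_res (V W : opens Z) (i : W `<=` V)
    (j : opreim gfc W `<=` opreim gfc V) (s : fs_sheaf Z V) :
  gf_comor W (tres i s) = tres j (gf_comor V s).
Proof.
have [_ comp _ _] := tsheafP (fs_sheaf X).
pose gW := opreim (bmap_continuous g) W; pose gV := opreim (bmap_continuous g) V.
have k : gW `<=` gV by move=> y; exact: i.
have l : opreim (bmap_continuous f) gW `<=` opreim (bmap_continuous f) gV by [].
have h : opreim gfc W `<=` opreim (bmap_continuous f) gV by [].
rewrite /gf_comor /= (comor_res (m := g) i k) (comor_res (m := f) k l).
by rewrite (comp _ _ _ _ _ h) (comp _ _ _ _ _ h).
Qed.

Lemma comp_local (V : opens Z) (s : fs_sheaf Z V) (x : X) : oset V (g (f x)) ->
  germ_unit (O := fs_sheaf X) (gf_comor V s) x -> germ_unit (O := fs_sheaf Z) s (g (f x)).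
Proof.
move=> Vx [W [i [Wx u]]]; apply: comor_local => //.
apply: (@comor_local _ _ f (opreim (bmap_continuous g) V)) => //.
have [_ comp _ _] := tsheafP (fs_sheaf X).
have k : W `<=` opreim (bmap_continuous f) (opreim (bmap_continuous g) V) by [].
by exists W, k; split=> //; move: u; rewrite /= (comp _ _ _ _ _ k).
Qed.

Definition mor_comp : mor X Z := Mor comp_continuous comp_res comp_local.

End Composition.

(** * The absolute Frobenius *)

Definition charp (p : nat) (X : lnFormalScheme) : Prop :=
  forall U : opens X, p%:R = 0 :> fs_sheaf X U.

Section Frobenius.
Variables (p : nat) (pr_p : prime p).

Lemma charp_mor (X Y : lnFormalScheme) (f : mor X Y) : charp p Y -> charp p X.
Proof.
move=> pY U; pose T : opens Y := Opens openT.
have i : U `<=` opreim (bmap_continuous f) T by [].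
by rewrite -(rmorph_nat (tres i)) -(rmorph_nat (comor f T)) pY !rmorph0.
Qed.

Lemma frob_add (R : comPzRingType) (x y : R) : p%:R = 0 :> R ->
  (x + y) ^+ p = x ^+ p + y ^+ p.
Proof.
case: p pr_p => // n pn p0; rewrite exprDn big_ord_recr big_ord_recl /=.
rewrite subn0 subnn bin0 binn !mulr1n expr0 mul1r mulr1.
rewrite big1 ?addr0 // => i _; rewrite -mulr_natr.
have /dvdnP [k ->] : n.+1 %| 'C(n.+1, bump 0 i).
  by apply: prime_dvd_bin => //=; rewrite /bump /= add1n ltnS ltn_ord.
by rewrite natrM p0 !mulr0.
Qed.

Lemma exp_continuous (R : topComRingType) n : continuous (fun x : R => x ^+ n).
Proof.
elim: n => [|n IHn] x; first exact: cvg_cst.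
under eq_fun do rewrite exprS.
apply: (@continuous_comp _ _ _ (fun y : R => (y, y ^+ n))
  (fun z : R * R => z.1 * z.2)); last exact: mul_continuous.
by apply: cvg_pair; [exact: cvg_id|exact: IHn].
Qed.

Variables (X : lnFormalScheme) (pX : charp p X).

Let idc : continuous (@idfun X) := fun x => @cvg_id _ (nbhs x).

Let idsub (V : opens X) : opreim idc V `<=` V := fun x Vx => Vx.

Definition frob (V : opens X) (s : fs_sheaf X V) : fs_sheaf X (opreim idc V) :=
  tres (@idsub V) s ^+ p.

Lemma frob_zmod V : zmod_morphism (@frob V).
Proof.
move=> s t; rewrite /frob rmorphB.
have := @frob_add _ (tres (@idsub V) s - tres (@idsub V) t)
  (tres (@idsub V) t) (pX _).
by rewrite subrK => ->; rewrite addrK.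
Qed.

Lemma frob_monoid V : monoid_morphism (@frob V).
Proof.
split; first by rewrite /frob rmorph1 expr1n.
by move=> s t; rewrite /frob rmorphM exprMn.
Qed.

HB.instance Definition _ V := GRing.isZmodMorphism.Build _ _ (@frob V) (@frob_zmod V).
HB.instance Definition _ V := GRing.isMonoidMorphism.Build _ _ (@frob V) (@frob_monoid V).

Lemma frob_continuous V : continuous (@frob V).
Proof.
move=> s; apply: (@continuous_comp _ _ _ (tres (@idsub V)) (fun t => t ^+ p)).
  exact: tres_continuous.
exact: exp_continuous.
Qed.

Lemma frob_res (V W : opens X) (i : W `<=` V)
    (j : opreim idc W `<=` opreim idc V) (s : fs_sheaf X V) :
  frob (tres i s) = tres j (frob s).
Proof.
have [_ comp _ _] := tsheafP (fs_sheaf X).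
have k : opreim idc W `<=` V by exact: i.
by rewrite /frob rmorphXn (comp _ _ _ _ _ k) (comp _ _ _ _ _ k).
Qed.

Lemma frob_local (V : opens X) (s : fs_sheaf X V) (x : X) : oset V (idfun x) ->
  germ_unit (O := fs_sheaf X) (frob s) x -> germ_unit (O := fs_sheaf X) s (idfun x).
Proof.
move=> Vx [W [i [Wx [t st]]]]; have k : W `<=` V by exact: i.
exists W, k; split=> //.
have [_ comp _ _] := tsheafP (fs_sheaf X).
move: st; rewrite /= /frob rmorphXn (comp _ _ _ _ _ k).
by rewrite -(prednK (prime_gt0 pr_p)) exprS -mulrA => st; eexists; exact: st.
Qed.

Definition abs_frobenius : mor X X :=
  @Mor X X idfun idc (fun V => @frob V) frob_continuous frob_res frob_local.

End Frobenius.

(** * Ideals of definition and adic morphisms *)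

Definition is_ideal_sheaf (X : topologicalType) (O : sheaf X)
    (J : forall U, set (O U)) : Prop :=
  [/\ (forall U, is_ideal (J U)),
      (forall (U V : opens X) (i : V `<=` U) s, J U s -> J V (res i s))
    & (forall (U : opens X) s,
         (forall x, oset U x ->
            exists (W : opens X) (i : W `<=` U), oset W x /\ J W (res i s)) ->
         J U s)].

(* Locally J = K^Delta for an ideal of definition K of a noetherian adic ring *)
(* A, the sheaf K^Delta on Spf A having sections K A_{f} over D(f).           *)
Definition is_ideal_of_def (X : lnFormalScheme)
    (J : forall U, set (fs_sheaf X U)) : Prop :=
  is_ideal_sheaf (O := fs_sheaf X) J /\
  forall x : X, exists (U : opens X) (c : formal_chart (fs_sheaf X) U)
      (K : set (fc_ring c)),
    [/\ oset U x, ring_ideal_of_def K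
      & forall (f : fc_ring c) (V : opens X) (i : V `<=` U),
          V = fc_map c @` basic_open f :> set X ->
          J V = ideal_gen ((tres i \o fc_sec c) @` K)].

(* The ideal f^*(K) O_X: sections that locally are O_X-linear combinations of *)
(* pullbacks of sections of K.                                                *)
Definition pull_ideal (X Y : lnFormalScheme) (f : mor X Y)
    (K : forall V, set (fs_sheaf Y V)) (U : opens X) : set (fs_sheaf X U) :=
  [set s | forall x, oset U x ->
    exists (V : opens Y) (W : opens X) (i : W `<=` U)
      (j : W `<=` opreim (bmap_continuous f) V),
    oset W x /\ ideal_gen ((tres j \o comor f V) @` K V) (tres i s)].

Arguments pull_ideal {X Y} f K U _.

Definition adic_mor (X Y : lnFormalScheme) (f : mor X Y) : Prop :=
  exists K, is_ideal_of_def K /\ is_ideal_of_def (pull_ideal f K).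

(** * Morphisms of pseudo finite type *)

(* [qpi : O -> quot] exhibits [quot] as the quotient sheaf O / J. *)
Record quotient_sheaf (X : topologicalType) (O : sheaf X)
    (J : forall U, set (O U)) := QuotientSheaf {
  quot :> sheaf X;
  qpi : forall U, {rmorphism O U -> quot U};
  qpi_res : forall (U V : opens X) (i : V `<=` U) s,
    qpi V (res i s) = res i (qpi U s);
  qpi_ker : forall U s, qpi U s = 0 <-> J U s;
  qpi_surj : forall (U : opens X) (q : quot U) x, oset U x ->
    exists (W : opens X) (i : W `<=` U) (s : O W), oset W x /\ qpi W s = res i q
}.

(* An isomorphism of (U, O|U) with Spec A. *)
Record spec_chart (X : topologicalType) (O : sheaf X) (U : opens X) :=
    SpecChart {
  sc_ring : comPzRingType;
  sc_map : Spec sc_ring -> X;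
  sc_embedding : open_embedding sc_map U;
  sc_sec : {rmorphism sc_ring -> O U};
  sc_loc : forall (f : sc_ring) (V : opens X) (i : V `<=` U),
    V = sc_map @` basic_open f :> set X -> is_localization f (res i \o sc_sec)
}.

Definition affine_open (X : topologicalType) (O : sheaf X) (U : opens X) : Prop :=
  inhabited (spec_chart O U).

(* The morphism of schemes (f, g) is of finite type: every point of Y has an  *)
(* affine open neighbourhood V whose preimage is a finite union of affine     *)
(* opens U_k with O_X(U_k) of finite type over O_Y(V).                        *)
Definition finite_type_mor (X Y : topologicalType) (OX : sheaf X) (OY : sheaf Y)
    (f : X -> Y) (fc : continuous f)
    (g : forall V : opens Y, {rmorphism OY V -> OX (opreim fc V)}) : Prop :=
  forall y : Y, exists V : opens Y, [/\ oset V y, affine_open OY V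
    & exists (n : nat) (U : 'I_n -> opens X) (i : forall k, U k `<=` opreim fc V),
        opreim fc V `<=` \bigcup_k (U k : set X) /\
        forall k, affine_open OX (U k) /\ finite_type_ring (res (i k) \o g V)].

Definition pseudo_finite_type (X Y : lnFormalScheme) (f : mor X Y) : Prop :=
  exists (J : forall U, set (fs_sheaf X U)) (K : forall V, set (fs_sheaf Y V))
    (QX : quotient_sheaf (O := fs_sheaf X) J)
    (QY : quotient_sheaf (O := fs_sheaf Y) K)
    (g : forall V : opens Y,
       {rmorphism QY V -> QX (opreim (bmap_continuous f) V)}),
  [/\ is_ideal_of_def J /\ is_ideal_of_def K,
      (forall U, pull_ideal f K U `<=` J U),
      (forall (V W : opens Y) (i : W `<=` V)
         (j : opreim (bmap_continuous f) W
              `<=` opreim (bmap_continuous f) V) (q : QY V),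
         g W (res i q) = res j (g V q)),
      (forall (V : opens Y) (s : fs_sheaf Y V),
         g V (qpi QY V s) = qpi QX _ (comor f V s))
    & finite_type_mor g].

(** * Fiber products and the relative Frobenius *)

(* In the category of locally noetherian formal schemes. *)
Definition is_fiber_product (X Y S P : lnFormalScheme)
    (f : mor X S) (g : mor Y S) (pr1 : mor P X) (pr2 : mor P Y) : Prop :=
  mor_eq (mor_comp f pr1) (mor_comp g pr2) /\
  forall (Z : lnFormalScheme) (u : mor Z X) (v : mor Z Y),
    mor_eq (mor_comp f u) (mor_comp g v) ->
    exists w : mor Z P,
      [/\ mor_eq (mor_comp pr1 w) u, mor_eq (mor_comp pr2 w) v
        & forall w' : mor Z P, mor_eq (mor_comp pr1 w') u ->
            mor_eq (mor_comp pr2 w') v -> mor_eq w' w].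

(* [F : X -> P] is the relative Frobenius of [f], where [P], with projections *)
(* [pr1] and [pr2], is the fiber product of [f] and the absolute Frobenius.   *)
Definition is_rel_frobenius (p : nat) (pr_p : prime p) (X Y P : lnFormalScheme)
    (f : mor X Y) (pY : charp p Y) (pr1 : mor P X) (pr2 : mor P Y)
    (F : mor X P) : Prop :=
  mor_eq (mor_comp pr1 F) (abs_frobenius pr_p (charp_mor f pY)) /\
  mor_eq (mor_comp pr2 F) f.

Definition homeomorphism (X Y : topologicalType) (f : X -> Y) : Prop :=
  continuous f /\
  exists g : Y -> X, [/\ continuous g, cancel f g & cancel g f].

(* Main.v *)
Require Import Defs.
From mathcomp Require Import all_boot ssralg.
From mathcomp Require Import all_classical topology tvs.

(* By the universal property, F o pr1 is the absolute Frobenius of X^(p),     *)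
(* while pr1 o F is that of X; both are the identity on points, so F and pr1  *)
(* are inverse homeomorphisms.  For adicity, let b : P -> X and a : X -> P be *)
(* such that a o b is the absolute Frobenius of P, and let J be an ideal of   *)
(* definition of X.  Then b^*(J) O_P is an ideal of definition of P: it is    *)
(* generated by topologically nilpotent sections, and it is open because it   *)
(* contains b^* a^* s = s^p for all s in some open ideal.  Being open, it is  *)
(* determined by its preimages in the chart rings, where quasi-coherence is a *)
(* matter of ordinary localization.  Apply this to b = pr1 and then to b = F. *)

Set Implicit Arguments.
Unset Strict Implicit.
Unset Printing Implicit Defensive.
Import GRing.Theory.
Local Open Scope classical_set_scope.
Local Open Scope ring_scope.

(** * Ideals *)

(** Both composites of [F] and [pr1] are absolute Frobenius morphisms: [pr1] after [F] by
    definition, [F] after [pr1] by uniqueness in the universal property ([rel_frobenius_pr1]). This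
    settles the topology, and adicity follows from [pull_ideal_of_def]: pullback along [b] preserves
    ideals of definition whenever some [a] after [b] is an absolute Frobenius.

    Openness of the pullback [H] rests on a fact about noetherian adic rings: an ideal is open as
    soon as all primes containing it are ([open_ideal_primes]). Hence the p-th powers of an open
    ideal generate an open ideal ([open_ideal_exp]), and locally [H] contains such powers
    ([pull_chart]).

    In a completed localization B of A at f, an open ideal I of A generates an open ideal IB, whose
    contraction is the f-saturation of I ([cloc_open], [cloc_contract]), and modulo IB every element
    is a fraction ([cloc_approx]). So the classical proof that a quasi-coherent ideal on an affine
    scheme comes from an ideal of the ring carries over to open ideals ([glue_ideal_of_def]). Its
    two inputs are local openness and generation ([pull_ideal_cover]) and nilpotence
    ([pull_ideal_spf]). *)

Section IdealTheory.
Variable R : comPzRingType.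
Implicit Types (I J E P : set R) (s : seq R).

Lemma ideal0 I : is_ideal I -> I 0. Proof. by case. Qed.

Lemma idealD I x y : is_ideal I -> I x -> I y -> I (x + y).
Proof. by case=> _ + _; apply. Qed.

Lemma idealMl I a x : is_ideal I -> I x -> I (a * x).
Proof. by case=> _ _; apply. Qed.

Lemma idealMr I a x : is_ideal I -> I x -> I (x * a).
Proof. by move=> iI Ix; rewrite mulrC; apply: idealMl. Qed.

Lemma idealN I x : is_ideal I -> I x -> I (- x).
Proof. by move=> iI Ix; rewrite -mulN1r; apply: idealMl. Qed.

Lemma idealB I x y : is_ideal I -> I x -> I y -> I (x - y).
Proof. by move=> iI Ix Iy; apply: idealD => //; apply: idealN. Qed.

Lemma ideal_sum I (T : Type) (r : seq T) (P : pred T) (F : T -> R) :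
  is_ideal I -> (forall i, P i -> I (F i)) -> I (\sum_(i <- r | P i) F i).
Proof.
move=> iI IF; apply: (big_ind I) => //; first exact: ideal0.
by move=> x y; apply: idealD.
Qed.

Lemma ideal_subE I x y : is_ideal I -> I (x - y) -> I y -> I x.
Proof. by move=> iI Ixy Iy; rewrite -(subrK y x); apply: idealD. Qed.

Lemma is_idealT : is_ideal (@setT R). Proof. by []. Qed.

Lemma is_idealI I J : is_ideal I -> is_ideal J -> is_ideal (I `&` J).
Proof.
move=> iI iJ; split; first by split; apply: ideal0.
  by move=> x y [? ?] [? ?]; split; apply: idealD.
by move=> a x [? ?]; split; apply: idealMl.
Qed.

Lemma ideal_gen_ideal E : is_ideal (ideal_gen E).
Proof.
split; first by move=> I [iI _]; apply: ideal0.
- by move=> x y Ex Ey I /[dup] IP [iI _]; apply: idealD (Ex _ IP) (Ey _ IP).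
- by move=> a x Ex I /[dup] IP [iI _]; apply: idealMl (Ex _ IP).
Qed.

Lemma sub_ideal_gen E : E `<=` ideal_gen E.
Proof. exact: sub_gen_smallest. Qed.

Lemma ideal_gen_min E I : is_ideal I -> E `<=` I -> ideal_gen E `<=` I.
Proof. by move=> iI EI x Ex; exact: (Ex I (conj iI EI)). Qed.

Lemma ideal_gen_mono E E' : E `<=` E' -> ideal_gen E `<=` ideal_gen E'.
Proof.
move=> EE'; apply: ideal_gen_min; first exact: ideal_gen_ideal.
by move=> x /EE'; apply: sub_ideal_gen.
Qed.

Lemma is_ideal_quot I a : is_ideal I -> is_ideal [set c | I (c * a)].
Proof.
move=> iI; split=> /=; first by rewrite mul0r; apply: ideal0.
  by move=> x y ? ?; rewrite mulrDl; apply: idealD.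
by move=> c x ?; rewrite -mulrA; apply: idealMl.
Qed.

Lemma is_ideal_addg I x : is_ideal I -> is_ideal [set y | exists r, I (y - r * x)].
Proof.
move=> iI; split=> /=; first by exists 0; rewrite mul0r subr0; apply: ideal0.
  move=> y z [r Ir] [t It]; exists (r + t).
  by rewrite mulrDl opprD addrACA; apply: idealD.
by move=> a y [r Ir]; exists (a * r); rewrite -mulrA -mulrBr; apply: idealMl.
Qed.

Definition radical I : set R := [set x | exists n, I (x ^+ n)].

Lemma is_ideal_radical I : is_ideal I -> is_ideal (radical I).
Proof.
move=> iI; split; first by exists 1; rewrite expr1; apply: ideal0.
  move=> x y [n xn] [m ym]; exists (n + m)%N; rewrite exprDn.
  apply: ideal_sum => // i _; rewrite -mulr_natr; apply: idealMr => //.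
  have [mi|im] := leqP m i.
    by apply: idealMl => //; rewrite -(subnK mi) exprD; apply: idealMl.
  apply: idealMr => //; suff ni : (n <= n + m - i)%N.
    by rewrite -(subnK ni) exprD; apply: idealMl.
  by rewrite -addnBA ?leq_addr// ltnW.
by move=> a x [n xn]; exists n; rewrite exprMn; apply: idealMl.
Qed.

Lemma prime_ideal_exp P x n : is_prime_ideal P -> P (x ^+ n) -> P x.
Proof.
case=> iP P1 PM; elim: n => [|n IHn]; first by rewrite expr0.
by rewrite exprS => /PM [].
Qed.

Lemma ideal_genU E x : ideal_gen E x ->
  exists s, [set` s] `<=` E /\ ideal_gen [set` s] x.
Proof.
move=> Ex; pose T := [set x | exists s, [set` s] `<=` E /\ ideal_gen [set` s] x].
apply: (Ex T); split; last first.
  move=> y Ey; exists [:: y]; split; first by move=> z /=; rewrite inE => /eqP ->.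
  by apply: sub_ideal_gen => /=; rewrite inE.
have gi := ideal_gen_ideal.
split; first by exists [::]; split=> //; apply: ideal0.
  move=> y z [s [sE sy]] [t [tE tz]]; exists (s ++ t); split.
    by move=> u /=; rewrite mem_cat => /orP[/sE|/tE].
  by apply: (idealD (gi _)); [apply: ideal_gen_mono sy|apply: ideal_gen_mono tz]
    => u /= us; rewrite mem_cat us ?orbT.
by move=> a y [s [sE sy]]; exists s; split=> //; apply: (idealMl _ (gi _)).
Qed.

Lemma noetherian_gen E : noetherian R ->
  exists s, [set` s] `<=` E /\ ideal_gen E = ideal_gen [set` s].
Proof.
move=> nR; have [t tE] := nR _ (ideal_gen_ideal E).
have : [set` t] `<=` ideal_gen E by rewrite tE; apply: sub_ideal_gen.
move=> tsub; suff [s [sE ts]] :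
    exists s, [set` s] `<=` E /\ [set` t] `<=` ideal_gen [set` s].
  exists s; split=> //; apply/seteqP; split; last exact: ideal_gen_mono.
  by rewrite tE; apply: ideal_gen_min => //; apply: ideal_gen_ideal.
elim: t tsub {tE} => [|x t IHt] tsub; first by exists [::]; split.
have [] := IHt; first by move=> y ty; apply: tsub => /=; rewrite inE [y \in t]ty orbT.
move=> s [sE ts]; have [|u [uE ux]] := @ideal_genU E x.
  by apply: tsub; rewrite /= inE eqxx.
exists (s ++ u); split; first by move=> y /=; rewrite mem_cat => /orP[/sE|/uE].
move=> y /=; rewrite inE => /orP[/eqP ->|/ts].
  by apply: ideal_gen_mono ux => z /= zs; rewrite mem_cat zs orbT.
by apply: ideal_gen_mono => z /= zs; rewrite mem_cat zs.
Qed.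

Lemma ideal_mul_ideal I J : is_ideal (ideal_mul I J).
Proof. exact: ideal_gen_ideal. Qed.

Lemma ideal_mulM I J x y : I x -> J y -> ideal_mul I J (x * y).
Proof. by move=> Ix Jy; apply: sub_ideal_gen; exists x, y. Qed.

Lemma ideal_mul_min I J T : is_ideal T ->
  (forall x y, I x -> J y -> T (x * y)) -> ideal_mul I J `<=` T.
Proof.
by move=> iT IJT; apply: ideal_gen_min => // _ [x [y [? ? ->]]]; apply: IJT.
Qed.

Lemma ideal_mul_seqP I s x : is_ideal I -> ideal_mul I (ideal_gen [set` s]) x ->
  exists c : nat -> R, (forall k, I (c k)) /\ x = \sum_(k < size s) c k * s`_k.
Proof.
move=> iI; pose S J := [set x | exists c : nat -> R,
  (forall k, J (c k)) /\ x = \sum_(k < size s) c k * s`_k].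
have iS J : is_ideal J -> is_ideal (S J).
  move=> iJ; split.
  - exists (fun=> 0); split=> [_|]; first exact: ideal0.
    by rewrite big1// => k _; rewrite mul0r.
  - move=> y z [c [Jc ->]] [d [Jd ->]]; exists (fun k => c k + d k); split=> [k|].
      exact: idealD.
    by rewrite -big_split /=; apply: eq_bigr => k _; rewrite mulrDl.
  - move=> a y [c [Jc ->]]; exists (fun k => a * c k); split=> [k|].
      exact: idealMl.
    by rewrite mulr_sumr; apply: eq_bigr => k _; rewrite mulrA.
have sS : ideal_gen [set` s] `<=` S setT.
  apply: ideal_gen_min => [|y /= ys]; first exact/iS/is_idealT.
  exists (fun k => (k == index y s)%:R); split=> //.
  have ls : (index y s < size s)%N by rewrite index_mem.
  rewrite (bigD1 (Ordinal ls)) //= eqxx mul1r nth_index// big1 ?addr0// => k.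
  by rewrite -val_eqE /= => /negbTE ->; rewrite mul0r.
apply: (@ideal_mul_min I _ (S I)) => [|y z Iy /sS [c [_ ->]]]; first exact: iS.
exists (fun k => y * c k); split=> [k|]; first exact: idealMr.
by rewrite mulr_sumr; apply: eq_bigr => k _; rewrite mulrA.
Qed.

Lemma ideal_pow_ideal I n : is_ideal (ideal_pow I n).
Proof. by case: n => [|n]; [exact: is_idealT|exact: ideal_mul_ideal]. Qed.

Lemma ideal_pow1 I : is_ideal I -> ideal_pow I 1 = I.
Proof.
move=> iI; apply/seteqP; split; last first.
  by move=> x Ix; rewrite -(mulr1 x); apply: ideal_mulM.
by apply: ideal_mul_min => // x y ? _; exact: idealMr.
Qed.

Lemma ideal_pow_exp I x n : I x -> ideal_pow I n (x ^+ n).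
Proof. by move=> Ix; elim: n => // n IHn; rewrite exprS; apply: ideal_mulM. Qed.

Lemma ideal_pow_sub I m n : (m <= n)%N -> ideal_pow I n `<=` ideal_pow I m.
Proof.
move=> /subnK <-; elim: (n - m)%N => // k IHk; rewrite addSn.
apply: ideal_mul_min => [|x y _ /IHk]; first exact: ideal_pow_ideal.
by apply: idealMl; exact: ideal_pow_ideal.
Qed.

Lemma ideal_pow_add I m n T : is_ideal T ->
  (forall x y, ideal_pow I m x -> ideal_pow I n y -> T (x * y)) ->
  ideal_pow I (m + n) `<=` T.
Proof.
elim: m T => [|m IHm] T iT IT; first by move=> y Iy; rewrite -(mul1r y); apply: IT.
apply: ideal_mul_min => // a w Ia; rewrite mulrC.
apply: (IHm [set w | T (w * a)]); first exact: is_ideal_quot.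
by move=> x y Ix Iy; rewrite /= mulrC mulrA; apply: IT => //; apply: ideal_mulM.
Qed.

(** Each of the finitely many generators of [I] lies in some member of the chain, and the largest of
    these members contains them all. *)
Lemma noetherian_bigcup (F : set (set R)) I : noetherian R -> is_ideal I ->
  total_on F subset -> F !=set0 -> (forall J, F J -> is_ideal J) ->
  I `<=` \bigcup_(J in F) J -> exists2 J, F J & I `<=` J.
Proof.
move=> nR iI Ft [J0 FJ0] Fi.
have [s ->] := nR _ iI => /(subset_trans (@sub_ideal_gen _)).
elim: s => [|x s IHs] sF.
  by exists J0 => //; apply: ideal_gen_min; [exact: Fi|move=> ? /=].
have [|J FJ sJ] := IHs.
  by move=> y ys; apply: sF; rewrite /= inE [y \in s]ys orbT.
have [|K FK Kx] := sF x; first by rewrite /= inE eqxx.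
have [JK|KJ] := Ft J K FJ FK.
  exists K => //; apply: ideal_gen_min => [|y]; first exact: Fi.
  rewrite /= inE => /orP[/eqP -> //|ys].
  by apply/JK/sJ; apply: sub_ideal_gen.
exists J => //; apply: ideal_gen_min => [|y]; first exact: Fi.
rewrite /= inE => /orP[/eqP -> //|ys]; first exact: KJ.
by apply/sJ; apply: sub_ideal_gen.
Qed.

(** Otherwise take P maximal among the ideals that contain [J] and no power of [I]. If x and y are
    outside P, then P + (x) and P + (y) contain powers of [I], so P + (xy) contains one as well, and
    xy is outside P. Thus P is prime, and by hypothesis it contains [I] itself, a contradiction. *)
Lemma ideal_pow_sub_primes I J : noetherian R -> is_ideal I -> is_ideal J ->
  (forall P, is_prime_ideal P -> J `<=` P -> I `<=` P) ->
  exists n, ideal_pow I n `<=` J.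
Proof.
move=> nR iI iJ IJ; apply: contrapT => /forallNP nIJ.
pose Q X := [/\ is_ideal X, J `<=` X & forall n, ~ ideal_pow I n `<=` X].
have QJ : Q J by split.
have [F FQ Ft|P [P0 Pmax]] := @Zorn_bigcup R [set X | X = set0 \/ Q X].
  pose G := F `&` Q.
  have FG : \bigcup_(X in F) X = \bigcup_(X in G) X.
    apply/seteqP; split=> x [X FX Xx]; exists X => //; last by case: FX.
    by split=> //; case: (FQ _ FX) => // X0; rewrite X0 in Xx.
  have [G0|/set0P GN] := eqVneq G set0; first by left; rewrite FG G0 bigcup_set0.
  have Gt : total_on G subset by move=> X Y [FX _] [FY _]; exact: Ft.
  right; rewrite FG; split.
  - have [X0 GX0] := GN; split.
    + by exists X0 => //; case: GX0 => _ [iX _ _]; apply: ideal0.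
    + move=> x y [X GX Xx] [Y GY Yy]; have [XY|YX] := Gt _ _ GX GY.
        by exists Y => //; case: GY => _ [iY _ _]; apply: idealD => //; apply: XY.
      by exists X => //; case: GX => _ [iX _ _]; apply: idealD => //; apply: YX.
    + by move=> a x [X GX Xx]; exists X => //; case: GX => _ [iX _ _]; apply: idealMl.
  - by have [X0 GX0] := GN; move=> x Jx; exists X0 => //; case: GX0 => _ [_ + _]; apply.
  - move=> n; have ip := @ideal_pow_ideal I n.
    move=> /(noetherian_bigcup nR ip Gt GN) [X [_ [iX _ _]]|] //.
    by move=> X [_ [_ _ /(_ n)]].
have QP : Q P.
  case: P0 => // P0; exfalso; apply: (Pmax J); last by right.
  by rewrite P0; split=> // /(_ 0 (ideal0 iJ)).
have [iP JP nP] := QP.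
have bigger x : ~ P x -> exists n, ideal_pow I n `<=` [set y | exists r, P (y - r * x)].
  move=> Px; apply: contrapT => /forallNP nI.
  apply: (Pmax [set y | exists r, P (y - r * x)]).
    split=> [y Py|]; first by exists 0; rewrite mul0r subr0.
    by move=> /(_ x) xP; apply/Px/xP; exists 1; rewrite mul1r subrr; apply: ideal0.
  right; split=> //; first exact: is_ideal_addg.
  by move=> y /JP Py; exists 0; rewrite mul0r subr0.
have pP : is_prime_ideal P.
  split=> // [P1|x y Pxy].
    by apply: (nP 0%N) => z _; rewrite -(mulr1 z); apply: idealMl.
  apply: contrapT => /not_orP [/bigger [n xn] /bigger [m ym]].
  apply: (nP (n + m)%N); apply: ideal_pow_add => // a b /xn [r Pr] /ym [t Pt].
  rewrite -[a](subrK (r * x)) -[b](subrK (t * y)) mulrDl [r * x * _]mulrDr.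
  apply: (idealD iP); first exact: idealMr.
  apply: (idealD iP); first exact: idealMl.
  by rewrite mulrACA; apply: idealMl.
by apply: (nP 1%N); rewrite ideal_pow1//; apply: IJ.
Qed.

End IdealTheory.

Lemma is_ideal_preim (R S : comPzRingType) (g : {rmorphism R -> S}) (I : set S) :
  is_ideal I -> is_ideal (g @^-1` I).
Proof.
move=> iI; split; rewrite /preimage /=; first by rewrite rmorph0; apply: ideal0.
  by move=> x y ? ?; rewrite rmorphD; apply: (idealD iI).
by move=> a x ?; rewrite rmorphM; apply: (idealMl _ iI).
Qed.

(** * Topological rings and completed localizations *)

Section TopologicalRingTheory.
Variable A : topComRingType.
Implicit Types (I J P V : set A).

Lemma nbhs0D V : nbhs 0 V ->
  exists2 U, nbhs (0 : A) U & forall x y, U x -> U y -> V (x + y).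
Proof.
move=> V0; have := @add_continuous A (0, 0); rewrite /continuous_at /= addr0.
move=> /(_ _ V0) [[U W] /= [U0 W0] UW]; exists (U `&` W); first exact: filterI.
by move=> x y [Ux _] [_ Wy]; apply: (UW (x, y)).
Qed.

Lemma nbhs_addr x V : nbhs x V -> nbhs 0 [set y | V (x + y)].
Proof.
move=> Vx; have := @add_continuous A (x, 0); rewrite /continuous_at /= addr0.
move=> /(_ _ Vx) [[U W] /= [Ux W0] UW]; apply: filterS W0 => y Wy.
by apply: (UW (x, y)); split=> //; apply: nbhs_singleton.
Qed.

Lemma nbhs_subr x V : nbhs 0 V -> nbhs x [set y | V (y - x)].
Proof.
move=> V0; have := @add_continuous A (x, - x); rewrite /continuous_at /= subrr.
move=> /(_ _ V0) [[U W] /= [Ux W0] UW]; apply: filterS Ux => y Uy.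
by apply: (UW (y, - x)); split=> //; apply: nbhs_singleton.
Qed.

Lemma nbhs0N V : nbhs 0 V -> nbhs (0 : A) [set y | V (- y)].
Proof.
by move=> V0; apply: (@opp_continuous A 0); rewrite /continuous_at oppr0.
Qed.

Lemma nbhs_rsubr x V : nbhs 0 V -> nbhs x [set y | V (x - y)].
Proof.
by move=> /nbhs0N /(nbhs_subr x); apply: filterS => y /=; rewrite opprB.
Qed.

Lemma nbhs0M a V : nbhs 0 V -> nbhs (0 : A) [set y | V (a * y)].
Proof.
move=> V0; have := @mul_continuous A (a, 0); rewrite /continuous_at /= mulr0.
move=> /(_ _ V0) [[U W] /= [Ua W0] UW]; apply: filterS W0 => y Wy.
by apply: (UW (a, y)); split=> //; apply: nbhs_singleton.
Qed.

Lemma nbhs0_open I : is_ideal I -> nbhs 0 I -> open I.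
Proof.
move=> iI I0; rewrite openE => x Ix; rewrite /interior.
by apply: filterS (nbhs_subr x I0) => y /(idealD iI) /(_ Ix); rewrite subrK.
Qed.

Lemma open_nbhs0 I : is_ideal I -> open I -> nbhs 0 I.
Proof. by move=> iI oI; apply: open_nbhs_nbhs; split=> //; apply: ideal0. Qed.

Lemma open_ideal_sub I J : is_ideal I -> is_ideal J -> open I -> I `<=` J -> open J.
Proof.
move=> iI iJ oI IJ; apply: nbhs0_open => //.
by apply: filterS IJ _; apply: open_nbhs0.
Qed.

Lemma ideal_of_def_prime I P : ring_ideal_of_def I -> is_prime_ideal P ->
  open P -> I `<=` P.
Proof.
case=> iI _ Inil pP oP x Ix.
have [n IP] : exists n, ideal_pow I n `<=` P.
  by apply: Inil; apply: open_nbhs0 => //; case: pP.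
by apply: prime_ideal_exp (n) pP _; apply/IP/ideal_pow_exp.
Qed.

Lemma hausdorff_eq0 (x : A) : hausdorff_space A ->
  (forall V, nbhs 0 V -> V x) -> x = 0.
Proof.
move=> hA xV; apply: hA => V W Vx W0; exists x; split; last exact: xV.
exact: nbhs_singleton.
Qed.

Definition null_seq (u : nat -> A) : Prop :=
  forall V, nbhs 0 V -> exists N, forall n, (N <= n)%N -> V (u n).

Lemma null_seqD u v : null_seq u -> null_seq v -> null_seq (fun n => u n + v n).
Proof.
move=> nu nv V /nbhs0D [U U0 UV]; have [N uN] := nu _ U0; have [M vM] := nv _ U0.
by exists (maxn N M) => n; rewrite geq_max => /andP[/uN ? /vM ?]; apply: UV.
Qed.

Lemma null_seqM a u : null_seq u -> null_seq (fun n => a * u n).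
Proof. by move=> nu V /(nbhs0M a) /nu. Qed.

Lemma null_seq_sum r (u : 'I_r -> nat -> A) : (forall k, null_seq (u k)) ->
  null_seq (fun n => \sum_(k < r) u k n).
Proof.
elim: r u => [|r IHr] u nu.
  under eq_fun do rewrite big_ord0.
  by move=> V V0; exists 0%N => n _; apply: nbhs_singleton.
by under eq_fun do rewrite big_ord_recr; apply: null_seqD; [apply: IHr|].
Qed.

End TopologicalRingTheory.

(** * Open ideals of noetherian adic rings *)

Section NoetherianAdic.
Variables (A : topComRingType) (nA : noetherian A) (aA : adic_ring A).

(** An open prime contains the ideal of definition [D]. If this holds for all primes over [I], then
    a power of [D], which is open, lies in [I]. *)
Lemma open_ideal_primes (I : set A) : is_ideal I ->
  (forall P, is_prime_ideal P -> I `<=` P -> open P) -> open I.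
Proof.
move=> iI IP; have [_ [D [dD oD]]] := aA.
have [|P pP /(IP _ pP) oP|n DI] := @ideal_pow_sub_primes A D I nA _ iI.
- by case: dD.
- exact: ideal_of_def_prime pP oP.
- exact: open_ideal_sub (ideal_pow_ideal D n) iI (oD n) DI.
Qed.

Lemma open_ideal_mul (I J : set A) : is_ideal I -> is_ideal J ->
  open I -> open J -> open (ideal_mul I J).
Proof.
move=> iI iJ oI oJ; apply: open_ideal_primes => [|P pP IJP].
  exact: ideal_mul_ideal.
have [iP _ PM] := pP.
have [IP|/existsNP [x /not_implyP [Ix Px]]] := pselect (I `<=` P).
  exact: open_ideal_sub iI iP oI IP.
apply: (open_ideal_sub iJ iP oJ) => y Jy.
have [/Px []|//] : P x \/ P y by exact: PM _ _ (IJP _ (ideal_mulM Ix Jy)).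
Qed.

(** A prime containing the n-th powers of the elements of [I] contains [I], hence is open. *)
Lemma open_ideal_exp (I : set A) n : is_ideal I -> open I ->
  open (ideal_gen [set x ^+ n | x in I]).
Proof.
move=> iI oI; apply: open_ideal_primes => [|P pP IP]; first exact: ideal_gen_ideal.
have [iP _ _] := pP; apply: (open_ideal_sub iI iP oI) => x Ix.
by apply: prime_ideal_exp (n) pP _; apply: IP; apply: sub_ideal_gen; exists x.
Qed.

End NoetherianAdic.

(** * Extension and contraction of open ideals for a completed localization *)

Section CompletedLocalization.
Variables (A B : topComRingType) (nA : noetherian A) (aA : adic_ring A).
Variables (f : A) (L : comPzRingType).
Variables (i : {rmorphism A -> L}) (j : {rmorphism L -> B}).
Hypotheses (loc : is_localization f i) (csB : complete_separated B)
  (jdense : dense (range j)).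
Hypothesis jtop : forall N : set L,
  (exists U : set A, [/\ is_ideal U, open U & ideal_gen (i @` U) `<=` N])
  <-> (exists V, nbhs (0 : B) V /\ j @^-1` V `<=` N).

Lemma localization_idealP (I : set A) l : is_ideal I ->
  ideal_gen (i @` I) l <-> exists u n, I u /\ l * i f ^+ n = i u.
Proof.
move=> iI; have [[v fv] den _] := loc.
have lE m n u : m * i f ^+ n = i u -> m = v ^+ n * i u.
  by move=> <-; rewrite mulrCA -exprMn [v * _]mulrC fv expr1n mulr1.
split=> [|[u [n [Iu /lE ->]]]]; last first.
  by apply: (idealMl _ (ideal_gen_ideal _)); apply: sub_ideal_gen; exists u.
move: l; apply: ideal_gen_min; last first.
  by move=> _ [u Iu <-]; exists u, 0%N; rewrite expr0 mulr1.
split=> /=.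
- by exists 0, 0%N; rewrite rmorph0 mul0r; split=> //; apply: ideal0.
- move=> x y [u [n [Iu xu]]] [w [m [Iw yw]]].
  exists (f ^+ m * u + f ^+ n * w), (n + m)%N; split.
    by apply: (idealD iI); apply: idealMl.
  rewrite rmorphD !rmorphM !rmorphXn -xu -yw exprD mulrDl; congr (_ + _).
    by rewrite mulrA mulrC.
  by rewrite mulrCA.
- move=> x y [u [n [Iu yu]]]; have [a [m xa]] := den x.
  exists (a * u), (m + n)%N; split; first exact: idealMl.
  by rewrite rmorphM -xa -yu exprD mulrACA.
Qed.

(** The closure in [B] of the image of [N]. For an open ideal it turns out to be the extended ideal,
    but openness and contraction are first proved for the closure. *)
Let clo (N : set L) : set B :=
  [set y | forall V, nbhs (0 : B) V -> exists l, N l /\ V (y - j l)].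

Lemma dense_approx (y : B) V : nbhs (0 : B) V -> exists l, V (y - j l).
Proof.
move=> /(nbhs_rsubr y) yV.
have [|z [yz [l _ lz]]] := jdense (O := (fun z => V (y - z))°) _ (open_interior _).
  by exists y; apply: yV.
by exists l; rewrite lz; apply: interior_subset yz.
Qed.

Lemma clo_ideal N : is_ideal N -> is_ideal (clo N).
Proof.
move=> iN; split.
- move=> V V0; exists 0; split; first exact: ideal0.
  by rewrite rmorph0 subr0; apply: nbhs_singleton.
- move=> x y xN yN V /nbhs0D [U U0 UV].
  have [l [Nl xl]] := xN _ U0; have [m [Nm ym]] := yN _ U0.
  exists (l + m); split; first exact: idealD.
  by rewrite rmorphD opprD addrACA; apply: UV.
- move=> a y yN V /nbhs0D [U U0 UV].
  have [l [Nl yl]] := yN _ (nbhs0M a U0).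
  have [m am] := dense_approx a (nbhs0M (j l) U0).
  exists (m * l); split; first exact: idealMl.
  rewrite rmorphM -(subrK (a * j l) (a * y)) -addrA -mulrBr -mulrBl [_ * j l]mulrC.
  exact: UV.
Qed.

Lemma sub_clo N : j @` N `<=` clo N.
Proof.
by move=> _ [l Nl <-] V V0; exists l; split=> //; rewrite subrr; apply: nbhs_singleton.
Qed.

Lemma clo_open (I : set A) : is_ideal I -> open I -> nbhs 0 (clo (ideal_gen (i @` I))).
Proof.
move=> iI oI; have [V [V0 jV]] : exists V, nbhs (0 : B) V /\
  j @^-1` V `<=` ideal_gen (i @` I) by apply: (jtop _).1; exists I; split.
(* A point [y] interior to [V] is approximated by elements [j l] that are still in [V], which forces
   [l] into the extended ideal. *)
apply: filterS (nbhs_interior V0) => y Vy W W0.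
have [|l [Wl Vl]] := @dense_approx y (W `&` [set e | V (y - e)]).
  apply: filterI => //; have := nbhs0N (nbhs_addr Vy).
  exact: filterS.
by exists l; split=> //; apply: jV; rewrite /preimage /= -(subKr y (j l)).
Qed.

Lemma clo_preim (I : set A) l : is_ideal I -> open I ->
  clo (ideal_gen (i @` I)) (j l) -> ideal_gen (i @` I) l.
Proof.
move=> iI oI; have [V [V0 jV]] : exists V, nbhs (0 : B) V /\
  j @^-1` V `<=` ideal_gen (i @` I) by apply: (jtop _).1; exists I; split.
move=> /(_ _ V0) [m [Im]]; rewrite -rmorphB => /jV.
by move=> lm; apply: ideal_subE lm Im; apply: ideal_gen_ideal.
Qed.

Lemma gen_sub_clo (I : set A) : is_ideal I ->
  ideal_gen ((j \o i) @` I) `<=` clo (ideal_gen (i @` I)).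
Proof.
move=> iI; apply: ideal_gen_min; first exact/clo_ideal/ideal_gen_ideal.
by move=> _ [a Ia <-]; apply: sub_clo; exists (i a) => //; apply: sub_ideal_gen; exists a.
Qed.

Lemma nbhs0_loc V : nbhs (0 : B) V ->
  exists U, [/\ is_ideal U, open U & ideal_gen (i @` U) `<=` j @^-1` V].
Proof. by move=> V0; apply: (jtop _).2; exists V; split. Qed.

(** The extended ideal lies in the closure of its counterpart in [L], and for open [I] that closure
    meets [L] in nothing more. What remains is clearing denominators. *)
Lemma contract_loc (I : set A) a : is_ideal I -> open I ->
  ideal_gen ((j \o i) @` I) (j (i a)) -> exists n, I (f ^+ n * a).
Proof.
move=> iI oI /(gen_sub_clo iI) /(clo_preim iI oI).
move=> /(localization_idealP _ iI) [u [n [Iu au]]]; have [_ _ ker] := loc.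
have [|m fm] := ker (a * f ^+ n - u).
  by rewrite rmorphB rmorphM rmorphXn au subrr.
exists (m + n)%N; move: fm; rewrite mulrBr => /subr0_eq fm.
by rewrite exprD -mulrA [f ^+ n * a]mulrC fm; apply: idealMl.
Qed.

Section Series.
Variables (I : set A) (s : seq A).
Hypotheses (dI : ring_ideal_of_def I) (oI : forall n, open (ideal_pow I n))
  (os : open (ideal_gen [set` s])).

Let Npow k := ideal_gen (i @` ideal_pow I k).
Let Nmul k := ideal_gen (i @` ideal_mul (ideal_pow I k) (ideal_gen [set` s])).

Lemma Npow_small V : nbhs 0 V -> exists n, Npow n `<=` j @^-1` V.
Proof.
move=> /nbhs0_loc [U [iU oU UV]].
have [_ _ /(_ U) [|n nU]] := dI; first exact: open_nbhs0.
exists n; apply: subset_trans UV; apply: ideal_gen_mono.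
exact: image_subset.
Qed.

Lemma Npow_sub m n : (m <= n)%N -> Npow n `<=` Npow m.
Proof.
move=> mn; apply: ideal_gen_mono; apply: image_subset; exact: ideal_pow_sub.
Qed.

(** The partial sums are Cauchy because [Npow k] becomes arbitrarily small, and [B] is complete. *)
Lemma Npow_series (c : nat -> L) : (forall k, Npow k (c k)) ->
  exists e : B, null_seq (fun n => \sum_(k < n) j (c k) - e).
Proof.
move=> cN; pose S n := \sum_(0 <= k < n) j (c k).
have [_ cB] := csB; have [|e Se] := cB (S @ \oo) _.
  move=> V /Npow_small [n nV]; exists (S n), n => // m /= nm.
  rewrite /S (big_cat_nat (leq0n n) nm)/= addrAC subrr add0r.
  rewrite -raddf_sum; apply: nV; rewrite big_nat_cond.
  apply: ideal_sum => [|k /andP[/andP[nk _] _]]; first exact: ideal_gen_ideal.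
  exact: Npow_sub nk _ (cN k).
exists e => V /(nbhs_subr e) /Se [N _ SN].
by exists N => n Nn; rewrite -(big_mkord xpredT (j \o c)); apply: SN.
Qed.

(* Successive approximation: an element of the closure of s is a series whose *)
(* k-th term lies in I^k s, and summing the coefficients of each generator    *)
(* separately writes it as a finite combination of the generators.            *)
Lemma clo_sub_gen :
  clo (ideal_gen (i @` ideal_gen [set` s])) `<=`
  ideal_gen ((j \o i) @` ideal_gen [set` s]).
Proof.
have gi (R : comPzRingType) (E : set R) : is_ideal (ideal_gen E) := ideal_gen_ideal E.
have oN k : nbhs 0 (clo (Nmul k)).
  apply: clo_open; first exact: ideal_mul_ideal.
  by apply: open_ideal_mul => //; exact: ideal_pow_ideal.
have Nmulpow k : Nmul k `<=` Npow k.
  apply: ideal_gen_mono; apply: image_subset.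
  apply: ideal_mul_min; first exact: ideal_pow_ideal.
  by move=> x y Ix _; apply: idealMr => //; exact: ideal_pow_ideal.
move=> y sy.
(* Since [clo (Nmul k.+1)] is a neighbourhood of 0, an element of [clo (Nmul k)] agrees modulo it
   with some [j l], [l] in [Nmul k]. Outside the closure the chosen value is a dummy 0. *)
have [step stepP] : {step : nat -> B -> L | forall k z, clo (Nmul k) z ->
    Nmul k (step k z) /\ clo (Nmul k.+1) (z - j (step k z))}.
  have := @choice (nat * B)%type L (fun p l => clo (Nmul p.1) p.2 ->
    Nmul p.1 l /\ clo (Nmul p.1.+1) (p.2 - j l)).
  case.
    move=> [k z] /=; have [/(_ _ (oN k.+1)) [l lP]|nz] := pselect (clo (Nmul k) z).
      by exists l.
    by exists 0.
  by move=> g gP; exists (fun k z => g (k, z)) => k z /(gP (k, z)).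
(* The remainder of [y] after [k] corrections. *)
pose Y := fix Y k := if k is k'.+1 then Y k' - j (step k' (Y k')) else y.
have YN k : clo (Nmul k) (Y k).
  elim: k => [|k /stepP []//]; rewrite /Y.
  move: sy; suff : ideal_gen [set` s] `<=` ideal_mul (ideal_pow I 0) (ideal_gen [set` s]).
    move=> sub sy V /sy [l [ls Vl]]; exists l; split=> //.
    by apply: ideal_gen_mono ls; apply: image_subset.
  by move=> z sz; rewrite -(mul1r z); apply: ideal_mulM.
pose m k := step k (Y k).
have mN k : Nmul k (m k) by have [] := stepP k _ (YN k).
have Y0 : null_seq Y.
  move=> V /nbhs0D [U U0 UV]; have [N NU] := Npow_small U0.
  exists N => n Nn; have [l [ln Ul]] := YN n _ U0.
  rewrite -(subrK (j l) (Y n)); apply: UV => //.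
  by apply: NU; apply: Npow_sub Nn _ _; apply: Nmulpow.
have [c cP] : {c : nat -> nat -> L & forall k, (forall t, Npow k (c k t)) /\
    m k = \sum_(t < size s) c k t * i s`_t}.
  apply: (@choice nat (nat -> L) (fun k c => (forall t, Npow k (c t)) /\
    m k = \sum_(t < size s) c t * i s`_t)) => k.
  have [v fv] : is_unit (i f) by case: loc.
  have [u [n [su mu]]] := (localization_idealP _ (ideal_mul_ideal _ _)).1 (mN k).
  have [d [dk uE]] := ideal_mul_seqP (ideal_pow_ideal _ _) su.
  exists (fun t => v ^+ n * i (d t)); split=> [t|].
    by apply: (idealMl _ (gi _ _)); apply: sub_ideal_gen; exists (d t).
  have -> : m k = v ^+ n * i u.
    by rewrite -mu mulrCA -exprMn [v * _]mulrC fv expr1n mulr1.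
  rewrite uE rmorph_sum mulr_sumr; apply: eq_bigr => t _.
  by rewrite rmorphM mulrA.
have [e eP] : {e : nat -> B & forall t, null_seq (fun n => \sum_(k < n) j (c k t) - e t)}.
  apply: (@choice nat B (fun t e => null_seq (fun n => \sum_(k < n) j (c k t) - e))) => t.
  by apply: (Npow_series (c := c^~ t)) => k; case: (cP k).
have YE n : y = Y n + \sum_(t < size s) (\sum_(k < n) j (c k t)) * j (i s`_t).
  elim: n => [|n IHn]; first by rewrite big1 ?addr0// => t _; rewrite big_ord0 mul0r.
  under eq_bigr do rewrite big_ord_recr /= mulrDl.
  have -> : Y n.+1 = Y n - j (m n) by [].
  rewrite big_split /= addrACA -IHn; have [_ {1}->] := cP n.
  rewrite rmorph_sum /=; under [X in - X + _]eq_bigr do rewrite rmorphM.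
  by rewrite addNr addr0.
(* For every n the difference of the two sides equals [Y n] plus the errors of the n-th partial sums
   times the generators. It is constant and the limit of a null sequence, hence 0 by
   separatedness. *)
have -> : y = \sum_(t < size s) e t * j (i s`_t).
  apply/subr0_eq/hausdorff_eq0; first by case: csB.
  move=> V V0.
  have : null_seq (fun n => Y n + \sum_(t < size s)
      (j (i s`_t) * (\sum_(k < n) j (c k t) - e t))).
    by apply: null_seqD => //; apply: null_seq_sum => t; apply: null_seqM.
  move=> /(_ _ V0) [N /(_ N (leqnn N))]; congr V.
  under eq_bigr do rewrite mulrC mulrBl.
  by rewrite sumrB addrA -YE.
apply: ideal_sum => // t _; apply: (idealMl _ (gi _ _)).
by apply: sub_ideal_gen; exists s`_t => //; apply: sub_ideal_gen; exact: mem_nth.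
Qed.

End Series.

Lemma clo_sub_gen_open (I : set A) : is_ideal I -> open I ->
  clo (ideal_gen (i @` I)) `<=` ideal_gen ((j \o i) @` I).
Proof.
move=> iI oI; have [s Is] := nA iI; rewrite {}Is in iI oI *.
by have [_ [D [dD oD]]] := aA; apply: clo_sub_gen dD oD oI.
Qed.

End CompletedLocalization.

Section CompletedLocalizationTheory.
Variables (A B : topComRingType) (nA : noetherian A) (aA : adic_ring A).
Variables (f : A) (phi : A -> B) (cl : is_completed_localization f phi).

Lemma cloc_unit : is_unit (phi f).
Proof.
have [L [i [j [[[v fv] _ _] -> _ _ _]]]] := cl.
by exists (j v) => /=; rewrite -rmorphM fv rmorph1.
Qed.

Lemma cloc_contract (I : set A) a : is_ideal I -> open I ->
  ideal_gen (phi @` I) (phi a) -> exists n, I (f ^+ n * a).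
Proof.
have [L [i [j [loc /funext -> csB jd jtop]]]] := cl.
exact: (contract_loc loc jd jtop).
Qed.

Lemma cloc_open (I : set A) : is_ideal I -> open I -> open (ideal_gen (phi @` I)).
Proof.
have [L [i [j [loc /funext -> csB jd jtop]]]] := cl.
move=> iI oI; apply: nbhs0_open; first exact: ideal_gen_ideal.
apply: filterS (clo_open jd jtop iI oI).
by apply: clo_sub_gen_open loc csB jd jtop _ iI oI.
Qed.

Lemma cloc_continuous0 V : nbhs (0 : B) V -> nbhs 0 (phi @^-1` V).
Proof.
have [L [i [j [loc /funext -> csB jd jtop]]]] := cl.
move=> /(nbhs0_loc jtop) [U [iU oU UV]]; apply: filterS (open_nbhs0 iU oU).
by move=> u Uu; apply: UV; apply: sub_ideal_gen; exists u.
Qed.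

(** Modulo an open ideal, density of the localization makes every element of the completion a
    fraction. *)
Lemma cloc_approx (I : set A) b : is_ideal I -> open I ->
  exists a n, ideal_gen (phi @` I) (b * phi f ^+ n - phi a).
Proof.
move=> iI oI; have /(open_nbhs0 (ideal_gen_ideal _)) I0 := cloc_open iI oI.
have [L [i [j [loc ji csB jd jtop]]]] := cl.
have [l bl] := dense_approx jd b I0; have [_ den _] := loc.
have [a [n la]] := den l; exists a, n.
rewrite !ji /= -la rmorphM rmorphXn -mulrBl.
exact: idealMr (ideal_gen_ideal _) bl.
Qed.

End CompletedLocalizationTheory.

(** * Ideal sheaves on a chart *)

Section SheafTheory.
Variables (X : topologicalType) (O : tsheaf X).

Lemma opens_eq (U V : opens X) : oset U = oset V -> U = V.
Proof.
case: U V => U oU [V oV] /= UV; case: V / UV oV => oV.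
by congr Opens; exact: Prop_irrelevance.
Qed.

Lemma tres_comp (U V W : opens X) (i : V `<=` U) (j : W `<=` V) (k : W `<=` U)
  (s : O U) : tres j (tres i s) = tres k s.
Proof. by have [_ comp _ _] := tsheafP O; exact: comp. Qed.

Variable J : forall U, set (O U).
Arguments J : clear implicits.
Hypothesis sJ : is_ideal_sheaf (O := O) J.

Lemma ideal_sheaf_ideal U : is_ideal (J U).
Proof. by have [+ _ _] := sJ; apply. Qed.

Lemma ideal_sheaf_res (U V : opens X) (i : V `<=` U) s :
  J U s -> J V (tres i s).
Proof. by have [_ + _] := sJ; apply. Qed.

Lemma ideal_sheaf_local (U : opens X) (s : O U) :
  (forall x, oset U x ->
     exists (W : opens X) (i : W `<=` U), oset W x /\ J W (tres i s)) ->
  J U s.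
Proof. by have [_ _ +] := sJ; apply. Qed.

End SheafTheory.

Section ChartTheory.
Variables (X : topologicalType) (O : tsheaf X) (U : opens X) (c : formal_chart O U).
Let A := fc_ring c.

Lemma basic_open_open (h : A) : open (basic_open h : set (Spf A)).
Proof. by move=> q qh; exists h; split. Qed.

Definition bopen (h : A) : opens X :=
  Opens (let: And4 _ _ oc _ := fc_embedding c in oc _ (@basic_open_open h)).

Lemma bopenE h (q : Spf A) : oset (bopen h) (fc_map c q) <-> ~ zideal q h.
Proof.
have [inj _ _ _] := fc_embedding c.
by split=> [[r rh /inj <-] //|qh]; exists q.
Qed.

Lemma bopen_pt h x : oset (bopen h) x -> exists2 q : Spf A, ~ zideal q h & x = fc_map c q.
Proof. by move=> [q qh <-]; exists q. Qed.

Lemma chart_pt x : oset U x -> exists q, x = fc_map c q.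
Proof. by have [_ _ _ <-] := fc_embedding c; move=> [q _ <-]; exists q. Qed.

Lemma bopen_sub h : bopen h `<=` U.
Proof. by have [_ _ _ <-] := fc_embedding c; move=> _ [q _ <-]; exists q. Qed.

Lemma bopenMl f g : bopen (f * g) `<=` bopen f.
Proof.
move=> x /bopen_pt [q qfg ->]; apply/bopenE => qf; apply: qfg.
by apply: idealMr qf; case: (zidealP q).
Qed.

Lemma bopenMr f g : bopen (f * g) `<=` bopen g.
Proof. by rewrite mulrC; apply: bopenMl. Qed.

Lemma bopen_basis (W : opens X) (q : Spf A) : oset W (fc_map c q) ->
  exists2 h, ~ zideal q h & bopen h `<=` W.
Proof.
move=> Wq; have [_ cc _ _] := fc_embedding c.
have /(_ q Wq) [h [qh hW]] : open (fc_map c @^-1` W).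
  by apply: open_comp; [move=> x _; exact: cc|exact: osetP].
by exists h => // _ [r rh <-]; apply: hW.
Qed.

Definition bsec h : {rmorphism A -> O (bopen h)} := tres (@bopen_sub h) \o fc_sec c.

Lemma bsec_res g h (i : bopen h `<=` bopen g) a : tres i (bsec g a) = bsec h a.
Proof. exact: tres_comp. Qed.

Lemma bsec_cloc h : is_completed_localization h (bsec h).
Proof. exact: fc_loc. Qed.

Lemma chart_noetherian : noetherian A. Proof. exact: fc_noetherian. Qed.

Lemma chart_adic : adic_ring A. Proof. exact: fc_adic. Qed.

Lemma spf_ideal (q : Spf A) : is_ideal (zideal q). Proof. by case: (zidealP q). Qed.

Lemma spf_of_prime (P : set A) : is_prime_ideal P -> open P ->
  exists q : Spf A, P = zideal q.
Proof. by move=> pP oP; exists (Zspec (Q := [set P | open P]) pP oP). Qed.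

(** * Recovering an ideal sheaf on a chart from an ideal of the chart ring *)

Section Gluing.
Variable H : forall V, set (O V).
Arguments H : clear implicits.
Hypothesis sH : is_ideal_sheaf (O := O) H.

Let ctr h := bsec h @^-1` H (bopen h).

(** Quasi-coherence near [q], stated pointwise: membership in [H] over a smaller basic open set
    already holds over that of [g], after multiplication by some [b] not vanishing at the given
    point. *)
Hypothesis Hcover : forall q : Spf A, exists g, [/\ ~ zideal q g, open (ctr g)
  & forall h a, bopen h `<=` bopen g -> ctr h a ->
      forall r : Spf A, ~ zideal r h -> exists2 b, ~ zideal r b & ctr g (b * a)].
Hypothesis Hnil : forall a (q : Spf A), H U (fc_sec c a) -> zideal q a.

Let ctrE h a : ctr h a = H (bopen h) (bsec h a). Proof. by []. Qed.

Let ctr_ideal h : is_ideal (ctr h).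
Proof. exact: is_ideal_preim (ideal_sheaf_ideal sH _). Qed.

Lemma ctr_sub g h : bopen h `<=` bopen g -> ctr g `<=` ctr h.
Proof. by move=> hg a ga; rewrite ctrE -(bsec_res hg); exact: ideal_sheaf_res. Qed.

Lemma ctr_unit h n a : ctr h (h ^+ n * a) -> ctr h a.
Proof.
have [v hv] := cloc_unit (bsec_cloc h).
rewrite !ctrE rmorphM rmorphXn => ha.
have -> : bsec h a = v ^+ n * (bsec h h ^+ n * bsec h a).
  by rewrite mulrA -exprMn [v * _]mulrC hv expr1n mul1r.
by apply: idealMl ha; exact: ideal_sheaf_ideal.
Qed.

Let good g := open (ctr g) /\ forall h a, bopen h `<=` bopen g -> ctr h a ->
      forall r : Spf A, ~ zideal r h -> exists2 b, ~ zideal r b & ctr g (b * a).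

(** A prime over the quotient ideal of [ctr g] by [a] contains [ctr g], so it is open and a point of
    the formal spectrum. There [good] supplies a multiplier unless [f * g] vanishes. Hence [f * g]
    lies in all these primes and a power of it in the quotient; the power of [g] is invertible over
    [bopen g] and drops out. *)
Lemma ctr_extend f g a : good g -> ctr f a -> exists n, ctr g (f ^+ n * a).
Proof.
move=> [og gg] fa; have fga : ctr (f * g) a by apply: ctr_sub fa; apply: bopenMl.
have iQ := is_ideal_quot a (ctr_ideal g).
have [P pP gP|n nP] := @ideal_pow_sub_primes _ (ideal_gen [set f * g])
  [set b | ctr g (b * a)] chart_noetherian (ideal_gen_ideal _) iQ.
- have [iP _ _] := pP; apply: ideal_gen_min => // _ ->; apply: contrapT => Pfg.
  have [|q Pq] := spf_of_prime pP.
    apply: (open_ideal_sub (ctr_ideal g) iP og) => b gb.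
    by apply: gP; apply: idealMr.
  rewrite Pq in Pfg gP; have [b qb gb] := gg _ _ (@bopenMr f g) fga _ Pfg.
  by apply: qb; apply: gP.
- exists n; apply: (@ctr_unit g n).
  by rewrite mulrCA mulrA -exprMn; apply: nP; apply: ideal_pow_exp; apply: sub_ideal_gen.
Qed.

(** Quasi-compactness: the ideal generated by all good elements is generated by finitely many of
    them, and a point at which these vanish would contradict [Hcover]. *)
Lemma finite_cover : exists s : seq A, (forall g, g \in s -> good g) /\
  forall q : Spf A, exists2 g, g \in s & ~ zideal q g.
Proof.
have [s [sg gs]] := noetherian_gen [set g | good g] chart_noetherian.
exists s; split=> [g /sg //|q]; apply: contrapT => /forall2NP sq.
have [g [qg og gg]] := Hcover q; apply: qg.
have : ideal_gen [set` s] g by rewrite -gs; apply: sub_ideal_gen.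
apply: ideal_gen_min => [|h hs]; first exact: spf_ideal.
by apply: contrapT => qh; have [] := sq h.
Qed.

Let K := [set a : A | H U (fc_sec c a)].

Let glued_ideal : is_ideal K.
Proof. exact: is_ideal_preim (ideal_sheaf_ideal sH _). Qed.

Lemma glued_sub f : K `<=` ctr f.
Proof. by move=> a Ka; exact: ideal_sheaf_res. Qed.

Lemma finite_cover_global (s : seq A) a :
  (forall q : Spf A, exists2 g, g \in s & ~ zideal q g) ->
  (forall g, g \in s -> ctr g a) -> K a.
Proof.
move=> sc sa; apply: (ideal_sheaf_local sH) => x /chart_pt [q ->].
have [g gs qg] := sc q; exists (bopen g), (@bopen_sub g).
by split; [apply/bopenE|exact: sa].
Qed.

Lemma glued_open : open K.
Proof.
have [s [sg sc]] := finite_cover.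
have [I [iI oI Is]] : exists I : set A, [/\ is_ideal I, open I &
    forall g, g \in s -> I `<=` ctr g].
  elim: s sg {sc} => [|g s IHs] sg.
    by exists setT; split=> //; exact: openT.
  have [|I [iI oI Is]] := IHs; first by move=> h hs; apply: sg; rewrite inE hs orbT.
  have [og _] := sg g (mem_head _ _).
  exists (ctr g `&` I); split; [exact: is_idealI|exact: openI|].
  by move=> h; rewrite inE => /orP[/eqP ->|/Is hI] a [] // _ /hI.
apply: open_ideal_sub iI glued_ideal oI _ => a Ia.
by apply: finite_cover_global sc _ => g gs; exact: Is gs _ Ia.
Qed.

(** A prime over the open ideal [ideal_pow D n] is a point of the formal spectrum, so it contains
    [K] by [Hnil]; hence a power of [K] lies in that ideal. *)
Lemma glued_ideal_of_def : ring_ideal_of_def K.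
Proof.
split; [exact: glued_ideal|exact: glued_open|] => V V0.
have [_ [D [dD oD]]] := chart_adic; have [iD _ Dnil] := dD.
have [n DV] := Dnil _ V0.
have [P pP DP a Ka|m KD] := @ideal_pow_sub_primes _ K (ideal_pow D n)
  chart_noetherian glued_ideal (ideal_pow_ideal _ _).
- have [|q ->] := spf_of_prime pP; last exact: Hnil.
  by have [iP _ _] := pP; apply: open_ideal_sub DP => //; exact: ideal_pow_ideal.
- by exists m; apply: subset_trans DV.
Qed.

(** Modulo the open ideal generated by [K], a section of [H] is a fraction with numerator [a] in
    [ctr f]. By [ctr_extend] on a finite cover, some [f ^+ m * a] is in [K], and [f] is invertible
    here. *)
Lemma glued_gen f : H (bopen f) = ideal_gen (bsec f @` K).
Proof.
have iH := ideal_sheaf_ideal sH (bopen f).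
apply/seteqP; split=> [s Hs|]; last first.
  by apply: ideal_gen_min => // _ [a Ka <-]; exact: glued_sub.
have [v fv] := cloc_unit (bsec_cloc f).
have [a [n sa]] := cloc_approx chart_noetherian chart_adic (bsec_cloc f) s
  glued_ideal glued_open.
have gi := ideal_gen_ideal (bsec f @` K).
have sub : ideal_gen (bsec f @` K) `<=` H (bopen f).
  by apply: ideal_gen_min => // _ [b Kb <-]; exact: glued_sub.
have fa : ctr f a.
  have := idealB iH (idealMr (bsec f f ^+ n) iH Hs) (sub _ sa).
  by rewrite subKr.
have [t [tg tc]] := finite_cover.
have [m Km] : exists m, K (f ^+ m * a).
  have [m mt] : exists m, forall g, g \in t -> ctr g (f ^+ m * a).
    elim: t tg {tc} => [|g t IHt] tg; first by exists 0%N.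
    have [|m mt] := IHt; first by move=> h ht; apply: tg; rewrite inE ht orbT.
    have [k kg] := ctr_extend (tg g (mem_head _ _)) fa.
    exists (m + k)%N => h; rewrite inE => /orP[/eqP ->|/mt hm].
      by rewrite exprD -mulrA; apply: idealMl.
    by rewrite addnC exprD -mulrA; apply: idealMl.
  by exists m; apply: finite_cover_global tc _.
have sE : bsec f (f ^+ m * a) * v ^+ m + (s * bsec f f ^+ n - bsec f a) =
    s * bsec f f ^+ n.
  rewrite rmorphM rmorphXn mulrAC -exprMn fv expr1n mul1r addrC subrK //.
have -> : s = s * bsec f f ^+ n * v ^+ n by rewrite -mulrA -exprMn fv expr1n mulr1.
apply: (idealMr _ gi); rewrite -sE; apply: (idealD gi) => //; apply: (idealMr _ gi).
by apply: sub_ideal_gen; exists (f ^+ m * a).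
Qed.

Lemma glue_ideal_of_def : exists I : set A, ring_ideal_of_def I /\
  forall (f : A) (V : opens X) (i : V `<=` U),
    V = fc_map c @` basic_open f :> set X ->
    H V = ideal_gen ((tres i \o fc_sec c) @` I).
Proof.
exists K; split; first exact: glued_ideal_of_def.
move=> f V i Vf; have VE : V = bopen f by exact: opens_eq.
by subst V; rewrite glued_gen (Prop_irrelevance i (@bopen_sub f)).
Qed.

End Gluing.

End ChartTheory.

Arguments bopen {X O U} c h.
Arguments bsec {X O U} c h.
Arguments bsec_cloc {X O U} c h.
Arguments chart_pt {X O U} c {x}.
Arguments chart_noetherian {X O U} c.
Arguments chart_adic {X O U} c.

(** * Pullback of ideals along morphisms *)

Section MorphismTheory.
Implicit Types X Y Z T : lnFormalScheme.

Lemma mor_eq_refl X Y (f : mor X Y) : mor_eq f f.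
Proof. by split=> // V s W i j; rewrite (Prop_irrelevance i j). Qed.

Lemma mor_eq_sym X Y (f g : mor X Y) : mor_eq f g -> mor_eq g f.
Proof. by move=> [fg fgs]; split=> [x|V s W i j]; rewrite ?fg//; apply/esym/fgs. Qed.

Lemma mor_eq_trans X Y (f g h : mor X Y) : mor_eq f g -> mor_eq g h -> mor_eq f h.
Proof.
move=> [fg fgs] [gh ghs]; split=> [x|V s W i j]; first by rewrite fg gh.
have k : W `<=` opreim (bmap_continuous g) V by move=> x /i; rewrite /= /preimage /= fg.
by rewrite (fgs _ _ _ i k); apply: ghs.
Qed.

Lemma comor_compE X Y Z (g : mor Y Z) (f : mor X Y) (V : opens Z) s (W : opens X)
    (i : W `<=` opreim (bmap_continuous (mor_comp g f)) V)
    (j : W `<=` opreim (bmap_continuous f) (opreim (bmap_continuous g) V)) :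
  tres i (comor (mor_comp g f) V s) = tres j (comor f _ (comor g V s)).
Proof. exact: tres_comp. Qed.

Lemma tres_comor X Y (f : mor X Y) (V V' : opens Y) (W : opens X) (k : V' `<=` V)
    (i : W `<=` opreim (bmap_continuous f) V')
    (j : W `<=` opreim (bmap_continuous f) V) s :
  tres i (comor f V' (tres k s)) = tres j (comor f V s).
Proof.
have l : opreim (bmap_continuous f) V' `<=` opreim (bmap_continuous f) V.
  by move=> x; exact: k.
by rewrite (comor_res (m := f) k l); exact: tres_comp.
Qed.

Lemma mor_eq_compr X Y Z (g g' : mor Y Z) (f : mor X Y) :
  mor_eq g g' -> mor_eq (mor_comp g f) (mor_comp g' f).
Proof.
move=> [gg' ggs]; split=> [x|V s W i j]; first by rewrite /= gg'.
rewrite !comor_compE.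
pose gV := opreim (bmap_continuous g) V.
have k : gV `<=` opreim (bmap_continuous g') V.
  by move=> y; rewrite /gV /= /preimage /= gg'.
have l : gV `<=` opreim (bmap_continuous g) V by [].
by rewrite -(tres_comor l i) -(tres_comor k i) (ggs _ _ _ l k).
Qed.

Lemma mor_comp_assoc X Y Z T (h : mor Z T) (g : mor Y Z) (f : mor X Y) :
  mor_eq (mor_comp h (mor_comp g f)) (mor_comp (mor_comp h g) f).
Proof.
split=> // V s W i j; rewrite !comor_compE.
exact/esym/tres_comor.
Qed.

(** * Naturality of Frobenius and the universal property *)

Section FrobeniusNatural.
Variables (p : nat) (pr_p : prime p).

Lemma tres_frob X (pX : charp p X) (V W : opens X) (s : fs_sheaf X V)
    (i : W `<=` opreim (bmap_continuous (abs_frobenius pr_p pX)) V) (j : W `<=` V) :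
  tres i (comor (abs_frobenius pr_p pX) V s) = tres j s ^+ p.
Proof. by rewrite rmorphXn; congr (_ ^+ _); exact: tres_comp. Qed.

Lemma abs_frobenius_natural X Y (f : mor X Y) (pX : charp p X) (pY : charp p Y) :
  mor_eq (mor_comp f (abs_frobenius pr_p pX)) (mor_comp (abs_frobenius pr_p pY) f).
Proof.
split=> // V s W i j; rewrite !comor_compE tres_frob.
rewrite rmorphXn /= rmorphXn; congr (_ ^+ _).
exact/esym/tres_comor.
Qed.

(* Both projections of F o pr1 and of the absolute Frobenius of Xp agree.     *)
Lemma rel_frobenius_pr1 X Y (f : mor X Y) (pY : charp p Y) Xp
    (pr1 : mor Xp X) (pr2 : mor Xp Y) (F : mor X Xp) :
  is_fiber_product f (abs_frobenius pr_p pY) pr1 pr2 ->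
  is_rel_frobenius pr_p f pY pr1 pr2 F ->
  mor_eq (mor_comp F pr1) (abs_frobenius pr_p (charp_mor pr2 pY)).
Proof.
move=> [sq univ] [F1 F2]; set Fr := abs_frobenius _ (charp_mor pr2 pY).
(* The test pair is the square of the fiber product precomposed with [Fr], so [Fr] is one solution;
   it remains to see that [F] after [pr1] is another. *)
have [|w [_ _ wuniq]] := univ Xp (mor_comp pr1 Fr) (mor_comp pr2 Fr).
  apply: mor_eq_trans (mor_comp_assoc _ _ _) _.
  apply: mor_eq_trans (mor_eq_compr _ sq) _.
  exact/mor_eq_sym/mor_comp_assoc.
have FrP : mor_eq Fr w by apply: wuniq; exact: mor_eq_refl.
apply: mor_eq_trans (mor_eq_sym FrP); apply: wuniq.
  apply: mor_eq_trans (mor_comp_assoc _ _ _) _.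
  apply: mor_eq_trans (mor_eq_compr _ F1) _.
  exact/mor_eq_sym/abs_frobenius_natural.
apply: mor_eq_trans (mor_comp_assoc _ _ _) _.
apply: mor_eq_trans (mor_eq_compr _ F2) _.
apply: mor_eq_trans sq _.
exact/mor_eq_sym/abs_frobenius_natural.
Qed.

End FrobeniusNatural.

End MorphismTheory.

Lemma ideal_gen_rmorph (R S : comPzRingType) (g : {rmorphism R -> S}) (E : set R) x :
  ideal_gen E x -> ideal_gen (g @` E) (g x).
Proof.
apply: (@ideal_gen_min _ E (g @^-1` ideal_gen (g @` E))).
  exact/is_ideal_preim/ideal_gen_ideal.
by move=> y Ey; apply: sub_ideal_gen; exists y.
Qed.

Arguments ideal_gen_rmorph {R S} g {E x}.

Definition opensI (X : topologicalType) (U V : opens X) : opens X :=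
  Opens (openI (osetP U) (osetP V)).

Lemma opensIl (X : topologicalType) (U V : opens X) : opensI U V `<=` U.
Proof. by move=> x []. Qed.

Lemma opensIr (X : topologicalType) (U V : opens X) : opensI U V `<=` V.
Proof. by move=> x []. Qed.

(** * The pullback of an ideal sheaf is an ideal sheaf *)

Section PullIdeal.
Variables (P X : lnFormalScheme) (b : mor P X).
Variable J : forall V, set (fs_sheaf X V).
Arguments J : clear implicits.
Hypothesis sJ : is_ideal_sheaf (O := fs_sheaf X) J.
Let H := pull_ideal b J.

Lemma pull_shrink (V V' : opens X) (W W' : opens P)
    (j : W `<=` opreim (bmap_continuous b) V)
    (j' : W' `<=` opreim (bmap_continuous b) V') (k : V' `<=` V) (l : W' `<=` W) s :
  ideal_gen ((tres j \o comor b V) @` J V) s ->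
  ideal_gen ((tres j' \o comor b V') @` J V') (tres l s).
Proof.
move=> /(ideal_gen_rmorph (tres l)); apply: ideal_gen_mono.
move=> _ [_ [t Jt <-] <-]; exists (tres k t); first exact: ideal_sheaf_res.
have m : W' `<=` opreim (bmap_continuous b) V by move=> x /j' /k.
by rewrite /= (tres_comor _ _ m) (tres_comp _ _ m).
Qed.

Lemma pull_ideal_comor (V : opens X) (W : opens P)
    (j : W `<=` opreim (bmap_continuous b) V) s :
  J V s -> H (tres j (comor b V s)).
Proof.
move=> Js x Wx; exists V, W, (fun=> id), j; split=> //.
apply: sub_ideal_gen; exists s => //=; by rewrite (tres_comp _ _ j).
Qed.

Lemma pull_ideal_sheaf : is_ideal_sheaf (O := fs_sheaf P) H.
Proof.
have gi (R : comPzRingType) (E : set R) : is_ideal (ideal_gen E) := ideal_gen_ideal E.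
split.
- move=> U; split.
  + move=> x Ux; exists (Opens openT), U, (fun=> id), (fun _ _ => I).
    by split=> //; rewrite rmorph0; exact: ideal0.
  + move=> s t Hs Ht x Ux.
    have [V [W [i [j [Wx Js]]]]] := Hs x Ux.
    have [V' [W' [i' [j' [Wx' Jt]]]]] := Ht x Ux.
    have k : opensI W W' `<=` opreim (bmap_continuous b) (opensI V V').
      by move=> z [/j ? /j' ?].
    have l : opensI W W' `<=` U by move=> z [/i].
    exists (opensI V V'), (opensI W W'), l, k; split=> //.
    rewrite rmorphD; apply: (idealD (gi _ _)).
      rewrite -(tres_comp i (@opensIl _ W W')).
      exact: pull_shrink (@opensIl _ V V') _ _ Js.
    rewrite -(tres_comp i' (@opensIr _ W W')).
    exact: pull_shrink (@opensIr _ V V') _ _ Jt.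
  + move=> r s Hs x Ux; have [V [W [i [j [Wx Js]]]]] := Hs x Ux.
    exists V, W, i, j; split=> //; rewrite rmorphM.
    exact: (idealMl _ (gi _ _)).
- move=> U U' i s Hs x Ux; have [V [W [k [j [Wx Js]]]]] := Hs x (i x Ux).
  have l : opensI W U' `<=` opreim (bmap_continuous b) V by move=> z [/j].
  exists V, (opensI W U'), (@opensIr _ W U'), l; split=> //.
  have m : opensI W U' `<=` U by move=> z [/k].
  change (ideal_gen [set (tres l \o comor b V) x | x in J V]
    (tres (@opensIr _ W U') (tres i s))).
  rewrite (tres_comp _ _ m) -(tres_comp k (@opensIl _ W U')).
  exact: pull_shrink (fun=> id) _ _ Js.
- move=> U s Hs x Ux; have [W [i [Wx /(_ x Wx)]]] := Hs x Ux.
  move=> [V [W' [k [j [Wx' Js]]]]].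
  have l : W' `<=` U by move=> z /k /i.
  exists V, W', l, j; split=> //.
  by rewrite -(tres_comp i k).
Qed.

End PullIdeal.

(** * Pullback along a factor of Frobenius *)

Section PullFrobenius.
Variables (p : nat) (pr_p : prime p) (P X : lnFormalScheme) (pP : charp p P).
Variables (b : mor P X) (a : mor X P).
Hypothesis ab : mor_eq (mor_comp a b) (abs_frobenius pr_p pP).
Variable J : forall V, set (fs_sheaf X V).
Arguments J : clear implicits.
Hypothesis dJ : is_ideal_of_def J.
Let H := pull_ideal b J.
Variables (U : opens P) (c : formal_chart (fs_sheaf P) U).
Let A := fc_ring c.

Let sJ : is_ideal_sheaf (O := fs_sheaf X) J. Proof. by case: dJ. Qed.

Lemma continuous_rmorph0 (R S : topComRingType) (g : {rmorphism R -> S}) V :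
  continuous g -> nbhs 0 V -> nbhs 0 (g @^-1` V).
Proof. by move=> cg V0; apply: cg; rewrite rmorph0. Qed.

(** The chart domain is the basic open set of 1, so [fc_sec] is itself a completed localization. *)
Lemma fc_sec_continuous0 V : nbhs 0 V -> nbhs 0 (fc_sec c @^-1` V).
Proof.
have UE : oset U = fc_map c @` basic_open 1.
  have [_ _ _ <-] := fc_embedding c; apply/seteqP; split=> x [q q1 <-]; exists q => //.
  by case: (zidealP q).
move=> /(cloc_continuous0 (fc_loc (fun=> id) UE)); apply: filterS => x.
by have [idr _ _ _] := tsheafP (fs_sheaf P); rewrite /preimage /= idr.
Qed.

(* Near any point the pullback of J is generated by the images of I, an ideal *)
(* of definition of a chart of X; it is open since the composite of a^* and   *)
(* b^* is s |-> s^p, whence it contains the p-th powers of an open ideal.     *)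
Lemma pull_chart (q : Spf A) : exists (g : A) (B : topComRingType) (I : set B)
    (t : {rmorphism B -> fs_sheaf P (bopen c g)}),
  [/\ ~ zideal q g, ring_ideal_of_def I /\ (forall V, nbhs 0 V -> nbhs 0 (t @^-1` V)),
      (forall u, I u -> H (t u)), open (bsec c g @^-1` @H (bopen c g))
    & forall h s, bopen c h `<=` bopen c g -> @H (bopen c h) s ->
      forall r : Spf A, ~ zideal r h ->
      exists h' (i : bopen c h' `<=` bopen c h) (j : bopen c h' `<=` bopen c g),
        ~ zideal r h' /\ ideal_gen ((tres j \o t) @` I) (tres i s)].
Proof.
have [_ abs] := ab; have abx x : a (b x) = x by exact: ab.1.
have Uq : oset U (fc_map c q).
  by have [_ _ _ <-] := fc_embedding c; exists q.
have [_ /(_ (b (fc_map c q))) [U' [c' [I [U'q dI JI]]]]] := dJ.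
have [q' bq] := chart_pt c' U'q.
have [iI oI _] := dI.
have [f' q'f' f'U] : exists2 f', ~ zideal q' f' &
    bopen c' f' `<=` opreim (bmap_continuous a) U.
  by apply: bopen_basis; rewrite /= /preimage /= -bq abx.
set D' := bopen c' f' in f'U.
have JE h : J (bopen c' h) = ideal_gen (bsec c' h @` I) by exact: JI.
(* The comorphism of [a] on chart level. The preimage of [J D'] under it is the open ideal whose
   p-th powers will lie in the pullback. *)
pose psi : {rmorphism A -> fs_sheaf X D'} := tres f'U \o (comor a U \o fc_sec c).
have psi0 V : nbhs 0 V -> nbhs 0 (psi @^-1` V).
  move=> /(continuous_rmorph0 (@tres_continuous _ _ _ _ f'U)).
  by move=> /(continuous_rmorph0 (@comor_continuous _ _ a U)) /fc_sec_continuous0.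
have iJ : is_ideal (J D') := ideal_sheaf_ideal sJ D'.
have oJ : open (J D').
  rewrite JE; apply: (cloc_open _ _ (bsec_cloc _ _)) => //.
    exact: chart_noetherian.
  exact: chart_adic.
have id : is_ideal (psi @^-1` J D') by exact: is_ideal_preim.
have od : open (psi @^-1` J D') by apply: nbhs0_open => //; apply/psi0/open_nbhs0.
have [g qg gD'] : exists2 g, ~ zideal q g &
    bopen c g `<=` opreim (bmap_continuous b) D'.
  by apply: bopen_basis; rewrite /= /preimage /= bq; apply/bopenE.
pose t : {rmorphism fc_ring c' -> fs_sheaf P (bopen c g)} :=
  tres gD' \o (comor b D' \o bsec c' f').
have sH : is_ideal_sheaf (O := fs_sheaf P) H := pull_ideal_sheaf b sJ.
exists g, (fc_ring c'), I, t; split=> //.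
- split=> // V /(continuous_rmorph0 (@tres_continuous _ _ _ _ gD')).
  move=> /(continuous_rmorph0 (@comor_continuous _ _ b D')).
  exact: (cloc_continuous0 (bsec_cloc c' f')).
- move=> u Iu; apply: (pull_ideal_comor gD').
  by rewrite JE; apply: sub_ideal_gen; exists u.
- have oE := open_ideal_exp (chart_noetherian c) (chart_adic c) p id od.
  have iH := is_ideal_preim (bsec c g) (ideal_sheaf_ideal sH (bopen c g)).
  apply: (open_ideal_sub (ideal_gen_ideal _) iH oE).
  apply: ideal_gen_min => // _ [d Jd <-].
  change (@H (bopen c g) (bsec c g (d ^+ p))).
  have -> : bsec c g (d ^+ p) = tres gD' (comor b D' (psi d));
    last exact: pull_ideal_comor.
  have i : bopen c g `<=` opreim (bmap_continuous (mor_comp a b)) U by move=> x /gD' /f'U.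
  have j : bopen c g `<=` opreim (bmap_continuous (abs_frobenius pr_p pP)) U.
    exact: bopen_sub.
  rewrite (tres_comor f'U gD' i) -(comor_compE (g := a) (f := b) (V := U) _ i i).
  rewrite (abs _ _ _ i j).
  by rewrite (tres_frob _ j (@bopen_sub _ _ _ c g)) rmorphXn.
- move=> h s hg Hs r rh.
  have hr : oset (bopen c h) (fc_map c r) by apply/bopenE.
  have [V [W [i [j [Wr Js]]]]] := Hs _ hr.
  have br : oset D' (b (fc_map c r)) by exact: gD' _ (hg _ hr).
  have [r' br'] := chart_pt c' (bopen_sub br).
  (* The local witness [V] of the pullback is unrelated to the chart [c']; shrinking to a basic open
     set of [c'] makes [J] there generated by [I]. *)
  have [f'' r'f'' f''V] : exists2 f'', ~ zideal r' f'' & bopen c' f'' `<=` opensI V D'.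
    by apply: bopen_basis; rewrite -br'; split=> //; exact: (j _ Wr).
  have [h' rh' h'W] : exists2 h', ~ zideal r h' & bopen c h' `<=`
      opensI W (opreim (bmap_continuous b) (bopen c' f'')).
    by apply: bopen_basis; split=> //; rewrite /= /preimage /= br'; apply/bopenE.
  have h'h : bopen c h' `<=` bopen c h by move=> x /h'W [/i].
  have h'g : bopen c h' `<=` bopen c g by move=> x /h'h /hg.
  have h'W1 : bopen c h' `<=` W by move=> x /h'W [].
  have h'b : bopen c h' `<=` opreim (bmap_continuous b) (bopen c' f'').
    by move=> x /h'W [].
  have f''V1 : bopen c' f'' `<=` V by move=> x /f''V [].
  have f''D' : bopen c' f'' `<=` D' by move=> x /f''V [].
  exists h', h'h, h'g; split=> //.
  have := pull_shrink sJ (j' := h'b) f''V1 h'W1 Js; rewrite (tres_comp _ _ h'h).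
  apply: ideal_gen_min => [|_ [w + <-]]; first exact: ideal_gen_ideal.
  rewrite JE => /(ideal_gen_rmorph (tres h'b \o comor b _)).
  apply: ideal_gen_mono => _ [_ [u Iu <-] <-]; exists u => //.
  have m : bopen c h' `<=` opreim (bmap_continuous b) D' by move=> x /h'g /gD'.
  transitivity (tres h'b (comor b _ (tres f''D' (bsec c' f' u)))).
    by rewrite (tres_comor f''D' h'b m); exact: tres_comp.
  by rewrite bsec_res.
Qed.

(** Near [q] the section is a combination of images of [I], which are topologically nilpotent by
    continuity. So a power of it lies in the extension of [D]; contracting, [h' ^+ m * x ^+ N] lies
    in [D], hence in [q], while [h'] does not. *)
Lemma pull_ideal_spf x (q : Spf A) : H (fc_sec c x) -> zideal q x.
Proof.
move=> Hx; have sH : is_ideal_sheaf (O := fs_sheaf P) H := pull_ideal_sheaf b sJ.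
have [g [B [I [t [qg [dI ct] _ _ gen]]]]] := pull_chart q.
have [|h' [i [j [qh']]]] := gen g (bsec c g x) (fun=> id) _ q qg.
  exact: (ideal_sheaf_res sH).
rewrite bsec_res => gx.
have [_ [D [dD oD]]] := chart_adic c; have [iD oD1 _] := dD.
pose M := ideal_gen (bsec c h' @` D).
have iM : is_ideal M := ideal_gen_ideal _.
have oM : open M.
  exact: (cloc_open (chart_noetherian c) (chart_adic c) (bsec_cloc _ _)).
have [n nM] : exists n, ideal_pow I n `<=` (tres j \o t) @^-1` M.
  have [_ _ nilI] := dI; apply: nilI.
  exact: ct (continuous_rmorph0 (@tres_continuous _ _ _ _ j) (open_nbhs0 iM oM)).
have /(_ _ gx) [N MN] : ideal_gen ((tres j \o t) @` I) `<=` radical M.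
  apply: ideal_gen_min => [|_ [u Iu <-]]; first exact: is_ideal_radical.
  exists n; rewrite -rmorphXn; apply: nM; exact: ideal_pow_exp.
have [m mD] : exists m, D (h' ^+ m * x ^+ N).
  by apply: (cloc_contract (bsec_cloc c h')) => //; rewrite rmorphXn.
have [_ _ qM] := zidealP q.
have /qM [] : zideal q (h' ^+ m * x ^+ N).
- exact: ideal_of_def_prime dD (zidealP q) (zidealQ q) _ mD.
- by move=> /(prime_ideal_exp (zidealP q)) /qh'.
- exact: prime_ideal_exp (zidealP q).
Qed.

(** The local generators [t u] are sections of [H] over [bopen c g], so by approximation modulo the
    open ideal generated by [G] they lie in that ideal. Over a smaller [bopen c h'] the element [x]
    then lies in the extension of [G], and contraction gives the multiplier, a power of [h']. *)
Lemma pull_ideal_cover (q : Spf A) : exists g, [/\ ~ zideal q g,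
    open (bsec c g @^-1` @H (bopen c g))
  & forall h x, bopen c h `<=` bopen c g -> (bsec c h @^-1` @H (bopen c h)) x ->
      forall r : Spf A, ~ zideal r h ->
      exists2 e, ~ zideal r e & (bsec c g @^-1` @H (bopen c g)) (e * x)].
Proof.
have sH : is_ideal_sheaf (O := fs_sheaf P) H := pull_ideal_sheaf b sJ.
have [g [B [I [t [qg _ tH og gen]]]]] := pull_chart q.
exists g; split=> // h x hg Hx r rh.
have [h' [i [j [rh']]]] := gen h (bsec c h x) hg Hx r rh.
rewrite bsec_res => hx.
set G := bsec c g @^-1` @H (bopen c g) in og *.
have iHg := ideal_sheaf_ideal sH (bopen c g).
have iG : is_ideal G by exact: is_ideal_preim.
have [n nG] : exists n, G (h' ^+ n * x).
  apply: (cloc_contract (bsec_cloc c h')) => //.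
  apply: ideal_gen_min hx => [|_ [u Iu <-]]; first exact: ideal_gen_ideal.
  have [v gv] := cloc_unit (bsec_cloc c g).
  have [w [n tw]] := cloc_approx (chart_noetherian c) (chart_adic c) (bsec_cloc c g)
    (t u) iG og.
  have sub : ideal_gen (bsec c g @` G) `<=` @H (bopen c g).
    by apply: ideal_gen_min => // _ [y Gy <-].
  have Gw : G w.
    have := idealB iHg (idealMr (bsec c g g ^+ n) iHg (tH u Iu)) (sub _ tw).
    by rewrite subKr.
  have tu : ideal_gen (bsec c g @` G) (t u).
    have gi := ideal_gen_ideal (bsec c g @` G).
    have -> : t u = t u * bsec c g g ^+ n * v ^+ n.
      by rewrite -mulrA -exprMn gv expr1n mulr1.
    apply: (idealMr _ gi); apply: ideal_subE gi tw _.
    by apply: sub_ideal_gen; exists w.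
  apply: ideal_gen_mono (ideal_gen_rmorph (tres j) tu).
  by move=> _ [_ [y Gy <-] <-]; exists y => //; rewrite bsec_res.
exists (h' ^+ n) => // rn; apply: rh'; apply: prime_ideal_exp rn; exact: zidealP.
Qed.

End PullFrobenius.

(** Stated for an arbitrary factorization of Frobenius so as to serve twice: with [b] equal to [pr1]
    and with [b] equal to [F]. *)
Lemma pull_ideal_of_def (p : nat) (pr_p : prime p) (P X : lnFormalScheme)
    (pP : charp p P) (b : mor P X) (a : mor X P) J :
  mor_eq (mor_comp a b) (abs_frobenius pr_p pP) -> is_ideal_of_def J ->
  is_ideal_of_def (pull_ideal b J).
Proof.
move=> ab dJ; have [sJ _] := dJ; have sH := pull_ideal_sheaf b sJ; split=> // x.
have [U [Ux [c]]] := fs_local x.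
have [I [dI IE]] := glue_ideal_of_def sH
  (pull_ideal_cover ab dJ (c := c)) (pull_ideal_spf ab dJ (c := c)).
by exists U, c, I.
Qed.

(* Xp, with projections pr1 and pr2, is X^(p) = X x_{Y, F_Y} Y; pr2 is f^(p). *)
Theorem proposition2p5 (p : nat) (pr_p : prime p) (X Y : lnFormalScheme)
  (f : mor X Y) (f_pft : pseudo_finite_type f) (pY : charp p Y)
  (Xp : lnFormalScheme) (pr1 : mor Xp X) (pr2 : mor Xp Y)
  (Xp_fiber : is_fiber_product f (abs_frobenius pr_p pY) pr1 pr2)
  (F : mor X Xp) (F_frob : is_rel_frobenius pr_p f pY pr1 pr2 F) :
  adic_mor F /\ homeomorphism F.
Proof.
have [F1 _] := F_frob; have [J [_ [_ [_ [_ [[dJ _] _ _ _ _]]]]]] := f_pft.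
have E := rel_frobenius_pr1 Xp_fiber F_frob.
split.
  (* The ideal of definition of [Xp] witnessing adicity is the pullback along [pr1] of the one on
     [X]; pulling it back again along [F] yields an ideal of definition of [X]. *)
  exists (pull_ideal pr1 J); have dK := pull_ideal_of_def E dJ.
  by split=> //; exact: pull_ideal_of_def F1 dK.
split; first exact: bmap_continuous.
exists pr1; split; first exact: bmap_continuous.
- by move=> x; exact: F1.1.
- by move=> x; exact: E.1.
Qed.
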